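(* Let $E$ be a separable Hilbert space. For every inner function $\xi\in H^\infty(\mathbb{D},E)$, let $C_\xi:H^2(\mathbb{D},E)\to H^2(\mathbb{D},\wedge^2E)$ be the pointwise creation operator $C_\xi f=\xi\,\dot\wedge\, f$. Then $$\{x\in H^2(\mathbb{D},E):\|C_\xi x\|_{H^2(\mathbb{D},\wedge^2E)}=\|x\|_{H^2(\mathbb{D},E)}\}=\mathrm{POC}(\{\xi\},H^2(\mathbb{D},E)).$$
   Context: $\mathbb{D}$ is the open unit disc and $\mathbb{T}$ the unit circle. Hilbert spaces are complex. Wedge products: for a Hilbert space $E$, $\otimes_H^2E$ is the completion of the algebraic tensor square of $E$ for the norm induced by the inner product $\langle x_1\otimes x_2,\,y_1\otimes y_2\rangle=2\langle x_1,y_1\rangle_E\langle x_2,y_2\rangle_E$ (note the factor $2=2!$). $\wedge^2E$ is the closed subspace of antisymmetric tensors (those changing sign under the unitary flip $x\otimes y\mapsto y\otimes x$), with the inherited inner product, and $x\wedge y$ is the orthogonal projection of $x\otimes y$ onto $\wedge^2E$. Consequently $\langle x_1\wedge x_2,\,y_1\wedge y_2\rangle_{\wedge^2E}=\det(\langle x_i,y_k\rangle_E)_{i,k=1}^2$. The pointwise wedge product is $(\xi\,\dot\wedge\, f)(z)=\xi(z)\wedge f(z)$. $H^\infty(\mathbb{D},E)$ is the space of bounded analytic $E$-valued functions on $\mathbb{D}$. $H^2(\mathbb{D},E)$ is the space of analytic $f:\mathbb{D}\to E$ with $\|f\|_{H^2(\mathbb{D},E)}=\sup_{0<r<1}\left(\frac1{2\pi}\int_0^{2\pi}\|f(re^{i\theta})\|_E^2\,d\theta\right)^{1/2}<\infty$.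 Functions in these spaces have radial limits in the norm of $E$ almost everywhere on $\mathbb{T}$, denoted by the same letter; via radial limits, $H^2(\mathbb{D},E)$ is identified isometrically with a closed subspace of $L^2(\mathbb{T},E)$. $\xi\in H^\infty(\mathbb{D},E)$ is inner if $\|\xi(z)\|_E=1$ for almost every $z\in\mathbb{T}$. For a subspace $F$ of $L^2(\mathbb{T},E)$ and a subset $X$ of $L^2(\mathbb{T},E)$, the pointwise orthogonal complement of $X$ in $F$ is $\mathrm{POC}(X,F)=\{f\in F:f(z)\perp\{x(z):x\in X\}\text{ for almost all }z\in\mathbb{T}\}$. *)

(* Defs.v *)
From HB Require Import structures.
From mathcomp Require Import all_boot all_order all_algebra sesquilinear.
From mathcomp Require Import all_classical all_reals all_analysis.
From mathcomp Require Import complex.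

Set Implicit Arguments.
Unset Strict Implicit.
Unset Printing Implicit Defensive.

Import Order.TTheory GRing.Theory Num.Theory.
Import numFieldNormedType.Exports.

Local Open Scope classical_set_scope.
Local Open Scope ring_scope.
Local Open Scope complex_scope.

(* The norm of a normed module over R[i] takes values in R[i]; the inner
   product is linear in its first argument. *)
Record hilbert (R : realType) := Hilbert {
  hilbert_sort :> completeNormedModType R[i];
  dotp : {dot hilbert_sort for (@Num.conj R[i])};
  dotpE : forall x, dotp x x = `|x| ^+ 2 }.

Definition rnorm (R : realType) (V : normedModType R[i]) (x : V) : R :=
  complex.Re `|x|.

Definition separable (T : topologicalType) : Prop :=
  exists2 S : set T, countable S & dense S.

Definition orth (R : realType) (E : hilbert R) (x y : E) : Prop :=
  dotp E x y = 0.

(* The orthogonal projection of x onto F; it is uniquely determined (and exists)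
   when F is a closed subspace. *)
Definition orth_proj (R : realType) (E : hilbert R) (F : set E) (x : E) : E :=
  xget 0 [set p | F p /\ forall y, F y -> orth (x - p) y].

(* A realization of the Hilbert tensor square of E.  The inner product formula
   makes the algebraic tensor square, with its inner product, embed
   isometrically as the span of the simple tensors; together with density and
   completeness this says that tensor_sort is its completion, so that two
   realizations are canonically isometric.  The flip is determined by its values
   on simple tensors. *)
Record tensor_square (R : realType) (E : hilbert R) := TensorSquare {
  tensor_sort :> hilbert R;
  tensor : {bilinear E -> E -> tensor_sort};
  dotp_tensor : forall x1 x2 y1 y2 : E,
    dotp tensor_sort (tensor x1 x2) (tensor y1 y2) =
    2%:R * dotp E x1 y1 * dotp E x2 y2;
  tensor_dense : dense [set t : tensor_sort |
    exists n (x y : 'I_n -> E), t = \sum_(i < n) tensor (x i) (y i)];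
  flip : {linear tensor_sort -> tensor_sort};
  flip_unitary : forall s t : tensor_sort,
    dotp tensor_sort (flip s) (flip t) = dotp tensor_sort s t;
  flip_tensor : forall x y : E, flip (tensor x y) = tensor y x }.

Definition wedge2 (R : realType) (E : hilbert R) (W : tensor_square E) : set W :=
  [set t | flip W t = - t].
Arguments wedge2 {R E} W.

Definition wedge (R : realType) (E : hilbert R) (W : tensor_square E)
  (x y : E) : W := orth_proj (wedge2 W) (tensor W x y).

Definition disc (R : realType) : set R[i] := [set z | `|z| < 1].
Arguments disc R : clear implicits.

Definition cis (R : realType) (t : R) : R[i] := cos t +i* sin t.

(* Complex differentiability at each point of the disc: the scalars, hence the
   increments in derivable, are complex.  Values off the disc are irrelevant. *)
Definition analytic (R : realType) (V : normedModType R[i]) (f : R[i] -> V) :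
  Prop := forall z, disc R z -> derivable (f : R[i]^o -> V) z 1.

Definition circle_mean (R : realType) (V : normedModType R[i]) (f : R[i] -> V)
  (r : R) : \bar R :=
  poweR ((2 * pi)^-1%:E * \int[lebesgue_measure]_(t in `[0%R, (2 * pi)%R])
           (rnorm (f (r%:C * cis t)) ^+ 2)%:E)%E 2^-1.

Definition hardy_norm (R : realType) (V : normedModType R[i]) (f : R[i] -> V) :
  \bar R := ereal_sup [set circle_mean f r | r in `]0, 1[].

(* H^2 and H^oo of functions with values in a closed subspace F of V. *)
Definition H2 (R : realType) (V : normedModType R[i]) (F : set V) :
  set (R[i] -> V) :=
  [set f | [/\ analytic f, forall z, disc R z -> F (f z)
             & (hardy_norm f < +oo)%E]].

Definition Hoo (R : realType) (V : normedModType R[i]) (F : set V) :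
  set (R[i] -> V) :=
  [set f | [/\ analytic f, forall z, disc R z -> F (f z)
             & exists M : R, forall z, disc R z -> rnorm (f z) <= M]].

Definition ae_circle (R : realType) (P : R[i] -> Prop) : Prop :=
  {ae @lebesgue_measure R, forall t : R, t \in `[0, 2 * pi] -> P (cis t)}.

(* The radial limit of f at z, for z on the unit circle. *)
Definition bdry (R : realType) (V : normedModType R[i]) (f : R[i] -> V)
  (z : R[i]) : V := lim (f (r%:C * z) @[r --> (1 : R)^'-]).

Definition inner (R : realType) (V : normedModType R[i]) (xi : R[i] -> V) :
  Prop := Hoo setT xi /\ ae_circle (fun z => rnorm (bdry xi z) = 1).

(* For sets X and F of functions on the unit circle; values off the circle are
   irrelevant. *)
Definition POC (R : realType) (E : hilbert R) (X F : set (R[i] -> E)) :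
  set (R[i] -> E) :=
  [set f | F f /\ ae_circle (fun z => forall x, X x -> orth (f z) (x z))].

Definition creation (R : realType) (E : hilbert R) (W : tensor_square E)
  (xi f : R[i] -> E) : R[i] -> W := fun z => wedge W (xi z) (f z).

(* Main.v *)
Require Import Defs.
From mathcomp Require Import all_boot all_order all_algebra sesquilinear.
From mathcomp Require Import all_classical all_reals all_analysis.
From mathcomp Require Import complex.
From mathcomp Require Import measurable_realfun ring lra.

Import Order.TTheory GRing.Theory Num.Theory.
Import numFieldNormedType.Exports.

Local Open Scope classical_set_scope.
Local Open Scope ring_scope.

(** Pointwise [|xi ^ x|^2 = |xi|^2 |x|^2 - |<x, xi>|^2], and [|xi| = 1] almost
    everywhere on the circle.  So the theorem follows once it is known that a
    function of H^2 has radial limits almost everywhere and that its H^2 norm is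
    the L^2 norm of its radial limits: the two norms then agree if and only if
    the integral of [|<x, xi>|^2] over the circle vanishes.

    Goursat's bisection argument in polar coordinates gives the mean value
    property, from which the Cauchy and Poisson formulas follow on centred
    circles.  Applied to [w |-> <f(w), f(z)>], the Poisson formula bounds
    [|f(z)|^2] by the Poisson average of [|f|^2] on a larger circle.  Hence the
    means of [|f|^2] on circles increase with the radius, and the radial maximal
    function of [|f|^2] is controlled by the Hardy-Littlewood maximal function.
    The parallelogram law turns the monotonicity of the means into smallness of
    [f - f(rho .)] in H^2 as [rho] tends to 1; with the maximal inequality this
    gives the radial limits, and with Fatou's lemma the isometry. *)

(** No vector-valued integral is formed: [f] enters integrals only through the scalar functions
    [w |-> <f(w), e>] and through [|f|^2]. The Poisson formula thus serves to produce an inequality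
    for [|f|^2], and the completeness of [E] enters through a Cauchy criterion for radial limits.

    The obstacle is the boundary function: [bdry f] is a limit known to exist only almost
    everywhere, with an arbitrary value elsewhere, so its measurability is not at hand. Integrals
    over the circle are therefore taken of the lower limit of [|f|^2] along one sequence of radii;
    it is measurable, and equals [|bdry f|^2] wherever the radial limit exists.

    Fatou's lemma gives one inequality of the isometry. The other compares [bdry f] with [f(rho .)],
    the error being the boundary value of [f - f(rho .)]. The smallness of this difference in H^2 is
    also what the weak type inequality turns into radial limits, so both halves rest on
    [mean2_tail], which is obtained from monotonicity and the parallelogram law without Taylor or
    Fourier coefficients. *)

Section rectangle.
Context {R : realType}.

(** Goursat's bisection for an abstract additive rectangle function: one of the four quarters keeps
    at least a quarter of [|J|], while the square of the half-perimeter also drops by four, so the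
    nested rectangles violate the local bound at their common point. *)
Lemma rect_additive_eq0 (J : R -> R -> R -> R -> R) (A B C D : R) :
  A <= B -> C <= D ->
  (forall a b c d m, A <= a -> a <= m -> m <= b -> b <= B ->
     C <= c -> c <= d -> d <= D -> J a b c d = J a m c d + J m b c d) ->
  (forall a b c d m, A <= a -> a <= b -> b <= B ->
     C <= c -> c <= m -> m <= d -> d <= D -> J a b c d = J a b c m + J a b m d) ->
  (forall p q, A <= p -> p <= B -> C <= q -> q <= D -> forall e, 0 < e ->
     exists2 dl, 0 < dl & forall a b c d, A <= a -> a <= p -> p <= b -> b <= B ->
       C <= c -> c <= q -> q <= d -> d <= D -> b - a < dl -> d - c < dl ->
       `|J a b c d| <= e * ((b - a) + (d - c)) ^+ 2) ->
  J A B C D = 0.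
Proof.
move=> AB CD addx addy loc.
apply: contrapT => /eqP J0.
pose w := B - A; pose l := D - C.
have w0 : 0 <= w by rewrite /w; lra.
have l0 : 0 <= l by rewrite /l; lra.
(* Chosen so that [|J A B C D|] strictly exceeds [e (w + l)^2]; the [+ 1] keeps the denominator
   positive for a degenerate rectangle. *)
pose e := `|J A B C D| / (2 * ((w + l) ^+ 2 + 1)).
have Jp : 0 < `|J A B C D| by rewrite normr_gt0.
have sp : 0 < (w + l) ^+ 2 + 1 by rewrite ltr_wpDl// sqr_ge0.
have e0 : 0 < e by rewrite /e divr_gt0// mulr_gt0.
pose half n := (2^-1 : R) ^+ n.
have halfp n : 0 < half n by rewrite /half exprn_gt0.
have halfS n : half n.+1 = half n / 2 by rewrite /half exprSr.
pose Bad n (x : R * R) := [/\ A <= x.1, x.1 + w * half n <= B, C <= x.2,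
   x.2 + l * half n <= D &
   e * (half n * (w + l)) ^+ 2 < `|J x.1 (x.1 + w * half n) x.2 (x.2 + l * half n)|].
have step n x : Bad n x -> exists y, Bad n.+1 y /\
   (x.1 <= y.1 /\ y.1 <= x.1 + w * half n.+1) /\ (x.2 <= y.2 /\ y.2 <= x.2 + l * half n.+1).
  case: x => a c [/= Aa bB Cc dD bad].
  have hn := halfp n; have hn1 := halfS n.
  set b := a + w * half n in bB bad *; set d := c + l * half n in dD bad *.
  have hw : 0 <= w * half n.+1 by rewrite mulr_ge0// ltW.
  have hl : 0 <= l * half n.+1 by rewrite mulr_ge0// ltW.
  have bE : b = a + w * half n.+1 + w * half n.+1 by rewrite /b hn1; field.
  have dE : d = c + l * half n.+1 + l * half n.+1 by rewrite /d hn1; field.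
  set m := a + w * half n.+1 in bE *; set k := c + l * half n.+1 in dE *.
  (* If no quarter were bad, additivity would bound [|J|] on the whole by four small terms,
     contradicting [bad]. *)
  apply: contrapT => no.
  have small a' c' : A <= a' -> a' + w * half n.+1 <= B -> C <= c' ->
     c' + l * half n.+1 <= D -> (a <= a' /\ a' <= m) -> (c <= c' /\ c' <= k) ->
     `|J a' (a' + w * half n.+1) c' (c' + l * half n.+1)| <= e * (half n.+1 * (w + l)) ^+ 2.
    move=> h1 h2 h3 h4 h5 h6; rewrite leNgt; apply/negP => h7.
    by apply: no; exists (a', c'); split.
  have am : a <= m by rewrite /m lerDl.
  have ck : c <= k by rewrite /k lerDl.
  have mb : m <= b by rewrite bE lerDl.
  have kd : k <= d by rewrite dE lerDl.
  have mB := le_trans mb bB; have Am := le_trans Aa am.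
  have kD := le_trans kd dD; have Ck := le_trans Cc ck.
  have cd := le_trans ck kd.
  have s1 := small a c Aa mB Cc kD (conj (lexx _) am) (conj (lexx _) ck).
  have s2 := small m c Am; rewrite -bE in s2; have {}s2 := s2 bB Cc kD (conj am (lexx _)) (conj (lexx _) ck).
  have s3 := small a k Aa mB Ck; rewrite -dE in s3; have {}s3 := s3 dD (conj (lexx _) am) (conj ck (lexx _)).
  have := small m k Am; rewrite -bE -dE => /(_ bB Ck dD (conj am (lexx _)) (conj ck (lexx _))) s4.
  have : `|J a b c d| <= 4 * (e * (half n.+1 * (w + l)) ^+ 2).
    rewrite (addx a b c d m)//.
    rewrite (addy a m c d k)//.
    rewrite (addy m b c d k)//.
    apply: le_trans (ler_normD _ _) _.
    apply: le_trans (lerD (ler_normD _ _) (ler_normD _ _)) _.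
    clear - s1 s2 s3 s4; lra.
  rewrite leNgt => /negP; apply; apply: le_lt_trans bad.
  rewrite hn1 le_eqVlt; apply/orP; left; apply/eqP; by field.
have [F FE] : exists F : nat -> R * R -> R * R, forall n x, Bad n x -> Bad n.+1 (F n x) /\
   (x.1 <= (F n x).1 /\ (F n x).1 <= x.1 + w * half n.+1) /\
    (x.2 <= (F n x).2 /\ (F n x).2 <= x.2 + l * half n.+1).
  (* The default [x] is returned only off the bad rectangles, which the sequence [s] never
     leaves. *)
  exists (fun n x => xget x [set y | Bad n.+1 y /\
   (x.1 <= y.1 /\ y.1 <= x.1 + w * half n.+1) /\ (x.2 <= y.2 /\ y.2 <= x.2 + l * half n.+1)]).
  by move=> i x /step exy; exact: (xgetPex x exy).
pose s := fix s n := if n is k.+1 then F k (s k) else (A, C).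
have bad0 : Bad 0%N (A, C).
  rewrite /Bad /half expr0 !mulr1 mul1r /=.
  have E1 : A + w = B by rewrite /w; ring.
  have E2 : C + l = D by rewrite /l; ring.
  rewrite E1 E2; split=> //.
  rewrite /e mulrAC ltr_pdivrMr ?mulr_gt0//.
  rewrite ltr_pM2l//. have := sqr_ge0 (w + l); lra.
have bads n : Bad n (s n) by elim: n => [//|n /FE[]].
(* Left ends increase and right ends decrease; stated for either projection, so that the common
   point is found one coordinate at a time as a supremum of left ends. *)
have mono (pr : R * R -> R) (L : R) :
    (forall n, pr (s n) <= pr (s n.+1) /\ pr (s n.+1) <= pr (s n) + L * half n.+1) ->
  (forall n k, pr (s n) <= pr (s (n + k)%N) /\
     pr (s (n + k)%N) + L * half (n + k)%N <= pr (s n) + L * half n).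
  move=> H j; elim=> [|k [IH1 IH2]]; first by rewrite addn0; lra.
  have [H1 H2] := H (j + k)%N; rewrite addnS; split; first by lra.
  have := halfS (j + k)%N; move=> E; rewrite E in H2 *; lra.
have st n := (FE n _ (bads n)).2.
have m1 := mono fst w (fun n => (st n).1).
have m2 := mono snd l (fun n => (st n).2).
have limit (pr : R * R -> R) (L a b : R) : 0 <= L -> 
  (forall n k, pr (s n) <= pr (s (n + k)%N) /\
     pr (s (n + k)%N) + L * half (n + k)%N <= pr (s n) + L * half n) ->
  exists p, forall n, pr (s n) <= p /\ p <= pr (s n) + L * half n.
  move=> L0 H.
  have bnd n k : pr (s k) <= pr (s n) + L * half n.
    have hnn i : 0 <= L * half i by rewrite mulr_ge0// ltW.
    case: (leqP n k) => nk.
      by have := H n (k - n)%N; rewrite subnKC// => -[_]; have := hnn k; lra.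
    by have := H k (n - k)%N; rewrite subnKC ?(ltnW nk)// => -[h _]; have := hnn n; lra.
  pose S := range (fun n => pr (s n)).
  have Sub n : ubound S (pr (s n) + L * half n) by move=> _ [k _ <-]; exact: bnd.
  have Ss : has_sup S by split; [exists (pr (s 0%N)), 0%N | exists (pr (s 0%N) + L * half 0%N); exact: Sub].
  exists (sup S) => n; split; first by apply: sup_upper_bound => //; exists n.
  by apply: ge_sup; [case: Ss | exact: Sub].
have [p Hp] := limit fst w A B w0 m1.
have [q Hq] := limit snd l C D l0 m2.
have [Hp0 Hp0'] := Hp 0%N; have [Hq0 Hq0'] := Hq 0%N.
rewrite /half expr0 !mulr1 /= in Hp0 Hp0' Hq0 Hq0'.
have pB : p <= B by move: Hp0'; rewrite /w; lra.
have qD : q <= D by move: Hq0'; rewrite /l; lra.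
have [dl dl0 Hdl] := loc p q Hp0 pB Hq0 qD _ e0.
have [n Hn] : exists n, half n * (w + l + 1) < dl.
  have : (half n * (w + l + 1)) @[n --> \oo] --> (0 : R).
    rewrite -(mul0r (w + l + 1)); apply: cvgMl.
    by apply: cvg_expr; rewrite ger0_norm; lra.
  move=> /cvgrPdist_lt/(_ _ dl0)[N _ HN]; exists N.
  have := HN N (leqnn N); rewrite /= sub0r normrN; apply: le_lt_trans; exact: ler_norm.
have [h1 h2 h3 h4] := bads n; rewrite ltNge => /negP; apply.
have [Hpn1 Hpn2] := Hp n; have [Hqn1 Hqn2] := Hq n.
have hw : 0 <= w * half n by rewrite mulr_ge0// ltW.
have hl : 0 <= l * half n by rewrite mulr_ge0// ltW.
have hh := halfp n.
apply: le_trans (Hdl _ _ _ _ h1 Hpn1 Hpn2 h2 h3 Hqn1 Hqn2 h4 _ _) _; [lra|lra|].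
by rewrite le_eqVlt; apply/orP; left; apply/eqP; ring.
Qed.

End rectangle.

(** * Real integrals of continuous functions over segments *)

Section segint.
Context {R : realType}.
Notation mu := (@lebesgue_measure R).
Implicit Types (f g F : R -> R).

(** Not an oriented integral: it is 0 when [b < a], which explains the order hypotheses in the
    lemmas below. *)
Definition segint f (a b : R) : R := \int[mu]_(t in `[a, b]) f t.

Definition cont_on f a b := {in `[a, b], continuous f}.

Lemma cont_on_integrable f a b : cont_on f a b ->
  mu.-integrable `[a, b] (EFin \o f).
Proof.
move=> cf; apply: continuous_compact_integrable; first exact: segment_compact.
by apply: continuous_in_subspaceT => x; rewrite inE/= => xab; exact: cf.
Qed.

Lemma segint_nil f a : segint f a a = 0.
Proof. by rewrite /segint set_itv1 Rintegral_set1. Qed.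

Lemma segint_split f a b c : cont_on f a b -> a <= c -> c <= b ->
  segint f a b = segint f a c + segint f c b.
Proof.
move=> cf ac cb; rewrite /segint.
have := @Rintegral_itvB R f (BLeft a) (BRight b) c (cont_on_integrable _ _ _ cf).
rewrite !bnd_simp => /(_ ac cb) E.
rewrite -(subrK (\int[mu]_(t in `[a, c]) f t) (\int[mu]_(t in `[a, b]) f t)) addrC E.
congr (_ + _); apply: Rintegral_itv_obnd_cbnd.
apply: integrableS (cont_on_integrable _ _ _ cf) => //.
by apply: subset_itv; rewrite bnd_simp.
Qed.

Lemma segint_cst k a b : a <= b -> segint (fun=> k) a b = k * (b - a).
Proof.
move=> ab; rewrite /segint Rintegral_cst//= lebesgue_measure_itv/= lte_fin.
by move: ab; rewrite le_eqVlt => /predU1P[->|->]//; rewrite ltxx subrr.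
Qed.

Lemma segint_le f g a b : cont_on f a b -> cont_on g a b ->
  (forall x, a <= x -> x <= b -> f x <= g x) -> segint f a b <= segint g a b.
Proof.
move=> cf cg fg; apply: le_Rintegral => //; [exact: cont_on_integrable..|].
by move=> x /=; rewrite in_itv/= => /andP[]; exact: fg.
Qed.

Lemma eq_segint g f a b : (forall x, a <= x -> x <= b -> f x = g x) ->
  segint f a b = segint g a b.
Proof.
by move=> fg; apply: eq_Rintegral => x; rewrite inE/= in_itv/= => /andP[]; exact: fg.
Qed.

Lemma segint_ge0 f a b : (forall x, a <= x -> x <= b -> 0 <= f x) -> 0 <= segint f a b.
Proof.
by move=> f0; apply: Rintegral_ge0 => x /=; rewrite in_itv/= => /andP[]; exact: f0.
Qed.

Lemma segintD f g a b : cont_on f a b -> cont_on g a b ->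
  segint (fun x => f x + g x) a b = segint f a b + segint g a b.
Proof. by move=> cf cg; apply: RintegralD => //; exact: cont_on_integrable. Qed.

Lemma segintB f g a b : cont_on f a b -> cont_on g a b ->
  segint (fun x => f x - g x) a b = segint f a b - segint g a b.
Proof. by move=> cf cg; apply: RintegralB => //; exact: cont_on_integrable. Qed.

Lemma segintZ k f a b : cont_on f a b ->
  segint (fun x => k * f x) a b = k * segint f a b.
Proof. by move=> cf; apply: RintegralZl => //; exact: cont_on_integrable. Qed.

Lemma cont_on_cst (k a b : R) : cont_on (fun=> k) a b.
Proof. by move=> x _; exact: cvg_cst. Qed.

Lemma cont_onD f g a b : cont_on f a b -> cont_on g a b -> cont_on (fun x => f x + g x) a b.
Proof. by move=> cf cg x xab; apply: continuousD; [exact: cf|exact: cg]. Qed.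

Lemma cont_onB f g a b : cont_on f a b -> cont_on g a b -> cont_on (fun x => f x - g x) a b.
Proof. by move=> cf cg x xab; apply: continuousB; [exact: cf|exact: cg]. Qed.

Lemma cont_onM f g a b : cont_on f a b -> cont_on g a b -> cont_on (fun x => f x * g x) a b.
Proof. by move=> cf cg x xab; apply: continuousM; [exact: cf|exact: cg]. Qed.

Lemma segint_dist f k e a b : a <= b -> cont_on f a b ->
  (forall x, a <= x -> x <= b -> `|f x - k| <= e) ->
  `|segint f a b - k * (b - a)| <= e * (b - a).
Proof.
move=> ab cf fk; rewrite ler_distl.
have -> : k * (b - a) - e * (b - a) = segint (fun=> k - e) a b.
  by rewrite segint_cst// mulrBl.
have -> : k * (b - a) + e * (b - a) = segint (fun=> k + e) a b.
  by rewrite segint_cst// mulrDl.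
apply/andP; split; apply: segint_le => //; try exact: cont_on_cst.
all: by move=> x ax xb; have := fk x ax xb; rewrite ler_distl => /andP[].
Qed.

(** Since [segint f A x] vanishes for [x < A], the derivative is claimed only strictly to the right
    of [A]. Later uses take [A] one unit below the interval of interest, so that the left end is
    covered too. *)
Lemma primitive_exists f (A : R) : continuous f -> exists F,
  (forall x, A < x -> is_derive x 1 F (f x)) /\
  (forall a b, A <= a -> a <= b -> segint f a b = F b - F a).
Proof.
move=> cf; have cfo a b : cont_on f a b by move=> x _; exact: cf.
exists (segint f A); split.
  move=> x Ax; have xx : x < x + 1 by rewrite ltrDl.
  have [|d1 d2] := @continuous_FTC1_closed R f A x (x + 1) xx _ Ax (cf x).
    exact: cont_on_integrable.
  by rewrite derive1E in d2; exact: (DeriveDef d1 d2).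
by move=> a b Aa ab; rewrite (segint_split f A b a)//; ring.
Qed.

Lemma segint_FTC f F a b : a <= b -> (forall x, a <= x -> x <= b -> {for x, continuous f}) ->
  (forall x, a <= x -> x <= b -> is_derive x 1 F (f x)) -> segint f a b = F b - F a.
Proof.
rewrite le_eqVlt => /predU1P[<- _ _|ab cf dF]; first by rewrite segint_nil subrr.
rewrite /segint /Rintegral (@continuous_FTC2 _ f F)//.
- by apply: continuous_in_subspaceT => x; rewrite inE/= in_itv/= => /andP[]; exact: cf.
- have cF x : a <= x -> x <= b -> {for x, continuous F}.
    move=> ax xb; apply: differentiable_continuous; apply/derivable1_diffP.
    by case: (dF x ax xb).
  split=> [x||].
  + by rewrite in_itv/= => /andP[/ltW ax /ltW xb]; case: (dF x ax xb).
  + by apply: cvg_at_right_filter; apply: cF => //; exact: ltW.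
  + by apply: cvg_at_left_filter; apply: cF => //; exact: ltW.
- move=> x; rewrite in_itv/= => /andP[/ltW ax /ltW xb].
  by rewrite derive1E; have ? := dF x ax xb; apply: derive_val.
Qed.

Lemma segint_shift f a b c : continuous f -> a <= b ->
  segint (fun x => f (x + c)) a b = segint f (a + c) (b + c).
Proof.
move=> cf ab; have [F [dF FE]] := primitive_exists f (a + c - 1) cf.
rewrite FE; [|lra|lra].
have cc x : {for x, continuous (fun x : R => x + c)}.
  by apply: cvgD; [exact: cvg_id|exact: cvg_cst].
apply: (segint_FTC (fun x => f (x + c)) (fun x => F (x + c)) a b ab).
  by move=> x _ _; apply: (@continuous_comp _ _ _ (fun x => x + c) f); [exact: cc|exact: cf].
move=> x ax xb; have dx : a + c - 1 < x + c by lra.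
have h := dF _ dx.
have dc : is_derive x (1 : R) (fun x : R => x + c) 1.
  by rewrite -[X in is_derive _ _ _ X]addr0; apply: is_deriveD.
rewrite -[X in is_derive _ _ _ X]mulr1.
exact: (@is_derive1_comp _ F (fun x => x + c)).
Qed.

Lemma segint_opp f a b : continuous f -> a <= b ->
  segint (fun x => f (- x)) a b = segint f (- b) (- a).
Proof.
move=> cf ab; have [F [dF FE]] := primitive_exists f (- b - 1) cf.
rewrite FE; [|lra|lra].
have -> : F (- a) - F (- b) = - F (- b) - - F (- a) by rewrite opprK addrC.
apply: (segint_FTC (fun x => f (- x)) (fun x => - F (- x)) a b ab).
  by move=> x _ _; apply: (@continuous_comp _ _ _ -%R f); [exact: opp_continuous|exact: cf].
move=> x ax xb; have dx : - b - 1 < - x by lra.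
have h := dF _ dx.
have dc : is_derive x (1 : R) (-%R : R -> R) (-1) by exact: is_deriveN.
have dc2 : is_derive x 1 (fun x => F (- x)) (f (- x) * -1).
  exact: (@is_derive1_comp _ F -%R).
have -> : f (- x) = - (f (- x) * -1) by rewrite mulrN1 opprK.
exact: is_deriveN.
Qed.

(** For [0 <= a] the window is cut at [T] and the overhang is shifted back by one period; a negative
    [a] is first raised by one period. *)
Lemma segint_periodic f T a : - T <= a -> a <= T -> continuous f -> (forall x, f (x + T) = f x) ->
  segint f a (a + T) = segint f 0 T.
Proof.
move=> Ta aT cf per.
have co c d : cont_on f c d by move=> x _; exact: cf.
have E u v : u <= v -> segint f u v = segint f (u + T) (v + T).
  by move=> uv; rewrite -segint_shift//; apply: eq_segint => x _ _; rewrite per.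
have half u : 0 <= u -> u <= T -> segint f u (u + T) = segint f 0 T.
  move=> u0 uT;  rewrite (segint_split f u (u + T) T)//; last by lra.
  rewrite (segint_split f 0 T u)// addrC; congr (_ + _).
  by rewrite (E 0 u)// add0r.
have [a0|a0] := leP 0 a; first exact: half.
by rewrite (E a (a + T)); [apply: half|]; lra.
Qed.

End segint.

Set Implicit Arguments.
Unset Strict Implicit.
Unset Printing Implicit Defensive.

Local Open Scope complex_scope.

(** * Real-valued moduli and norms *)

Section complex_abs.
Context {R : realType}.
Implicit Types (z w : R[i]) (r s t : R).

(** The norm of [R[i]] is itself an element of [R[i]]; taking its real part moves all estimates into
    the ordered field [R]. *)
Definition cabs z : R := complex.Re `|z|.

Lemma normCE z : `|z| = (cabs z)%:C.
Proof. by rewrite /cabs normc_def. Qed.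

Lemma cabsE z : cabs z = Num.sqrt (complex.Re z ^+ 2 + complex.Im z ^+ 2).
Proof. by rewrite /cabs normc_def. Qed.

Lemma cabs_ge0 z : 0 <= cabs z.
Proof. by rewrite cabsE sqrtr_ge0. Qed.

Lemma cabsD z w : cabs (z + w) <= cabs z + cabs w.
Proof. by rewrite -lecR -normCE (le_trans (ler_normD _ _))// !normCE -rmorphD. Qed.

Lemma cabsM z w : cabs (z * w) = cabs z * cabs w.
Proof. by apply: (@complexI R); rewrite -normCE normrM !normCE rmorphM. Qed.

Lemma cabsN z : cabs (- z) = cabs z.
Proof. by rewrite /cabs normrN. Qed.

Lemma cabsB z w : cabs (z - w) = cabs (w - z).
Proof. by rewrite -cabsN opprB. Qed.

Lemma cabs0 : cabs 0 = 0.
Proof. by rewrite /cabs normr0. Qed.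

Lemma cabs_eq0 z : (cabs z == 0) = (z == 0).
Proof. by rewrite -(@normr_eq0 _ _ z) normCE eq_complex/= eqxx andbT. Qed.

Lemma cabsR r : cabs r%:C = `|r|.
Proof. by rewrite cabsE/= expr0n addr0 sqrtr_sqr. Qed.

Lemma cabs1 : cabs 1 = 1.
Proof. by rewrite /cabs normr1. Qed.

Lemma cabsV z : cabs z^-1 = (cabs z)^-1.
Proof. by apply: (@complexI R); rewrite -normCE normfV !normCE fmorphV. Qed.

Lemma cabs_conj z : cabs z^*%C = cabs z.
Proof. by case: z => a b; rewrite !cabsE/= sqrrN. Qed.

Lemma ler_Re_cabs z : `|complex.Re z| <= cabs z.
Proof.
rewrite cabsE -sqrtr_sqr ler_wsqrtr// lerDl sqr_ge0//.
Qed.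

Lemma ler_Im_cabs z : `|complex.Im z| <= cabs z.
Proof. by rewrite cabsE -sqrtr_sqr ler_wsqrtr// lerDr sqr_ge0. Qed.

Lemma cabs_le_ReIm z : cabs z <= `|complex.Re z| + `|complex.Im z|.
Proof.
case: z => a b; have -> : a +i* b = a%:C + 'i%C * b%:C :> R[i].
  by simpc.
apply: le_trans (cabsD _ _) _; rewrite cabsM !cabsR [cabs 'i%C]cabsE/=.
by rewrite expr0n expr1n add0r sqrtr1 mul1r; simpc.
Qed.

Lemma cabs_cis t : cabs (cis t) = 1.
Proof. by rewrite cabsE/= cos2Dsin2 sqrtr1. Qed.

Lemma cisD s t : cis (s + t) = cis s * cis t :> R[i].
Proof. by rewrite /cis cosD sinD; simpc; congr (_ +i* _); rewrite addrC mulrC// [X in _ + X]mulrC. Qed.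

Lemma cis_periodic t : cis (t + 2 * pi) = cis t :> R[i].
Proof. by rewrite /cis mulr_natl cosD2pi sinD2pi. Qed.

End complex_abs.

Section rnorm_theory.
Context {R : realType} {V : normedModType R[i]}.
Implicit Types (x y : V).

Lemma normVE x : `|x| = (rnorm x)%:C.
Proof. by rewrite /rnorm RRe_real// normr_real. Qed.

Lemma rnorm_ge0 x : 0 <= rnorm x.
Proof. by rewrite -ler0c -normVE. Qed.

Lemma rnormD x y : rnorm (x + y) <= rnorm x + rnorm y.
Proof. by rewrite -lecR -normVE (le_trans (ler_normD _ _))// !normVE -rmorphD. Qed.

Lemma rnormN x : rnorm (- x) = rnorm x.
Proof. by rewrite /rnorm normrN. Qed.

Lemma rnormB x y : rnorm (x - y) = rnorm (y - x).
Proof. by rewrite -rnormN opprB. Qed.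

Lemma rnormZ c x : rnorm (c *: x) = cabs c * rnorm x.
Proof. by apply: (@complexI R); rewrite -normVE normrZ normVE normCE rmorphM. Qed.

Lemma rnorm0 : rnorm (0 : V) = 0.
Proof. by rewrite /rnorm normr0. Qed.

Lemma rnorm_eq0 x : (rnorm x == 0) = (x == 0).
Proof. by rewrite -(normr_eq0 x) normVE eq_complex/= eqxx andbT. Qed.

End rnorm_theory.

Lemma norm_diff_quotient (K : numFieldType) (V : normedModType K) (h : K) (x d : V) :
  h != 0 -> `|x - h *: d| = `|d - h^-1 *: x| * `|h|.
Proof.
move=> h0; have -> : x - h *: d = - (h *: (d - h^-1 *: x)).
  by rewrite scalerBr scalerA divff// scale1r opprB.
by rewrite normrN normrZ mulrC.
Qed.

Lemma derivable_near (K : numFieldType) (V : normedModType K) (f : K^o -> V) (z : K) :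
  derivable f z 1 -> forall e : K, 0 < e -> exists2 dl : K, 0 < dl &
  forall w, `|w - z| < dl -> `|f w - f z - (w - z) *: 'D_1 f z| <= e * `|w - z|.
Proof.
move=> df e e0.
have /cvgrPdist_le/(_ _ e0) : (fun h : K => h^-1 *: ((f \o shift z)
    (h *: (1 : K^o)) - f z)) @ 0^' --> 'D_1 f z by [].
move=> /nbhs_ballP[dl /= dl0 H]; exists dl => // w wz.
have [->|wnz] := eqVneq w z; first by rewrite !subrr scale0r subrr !normr0 mulr0.
have wz0 : w - z != 0 by rewrite subr_eq0.
have := H (w - z); rewrite /ball/= sub0r normrN => /(_ wz wz0).
rewrite /= /shift /= -[_ *: 1]/((w - z) * 1) mulr1 subrK => H1.
have := norm_diff_quotient (f w - f z) ('D_1 f z) wz0.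
by move=> ->; rewrite ler_wpM2r.
Qed.

Lemma derivable_of_near (K : numFieldType) (V : normedModType K) (f : K^o -> V) (z : K) (d : V) :
  (forall e : K, 0 < e -> exists2 dl : K, 0 < dl &
  forall w, `|w - z| < dl -> `|f w - f z - (w - z) *: d| <= e * `|w - z|) -> derivable f z 1.
Proof.
move=> H; apply/cvg_ex; exists d; apply/cvgrPdist_le => e e0.
have [dl dl0 {}H] := H _ e0.
apply/nbhs_ballP; exists dl => //= h; rewrite /ball/= sub0r normrN => hdl h0.
have := H (h + z); rewrite addrK => /(_ hdl) {}H.
rewrite /shift /= -[_ *: 1]/(h * 1) mulr1.
have E := norm_diff_quotient (f (h + z) - f z) d h0.
by rewrite E ler_pM2r ?normr_gt0 in H.
Qed.

(** * Complex differentiability in epsilon-delta form, with linear and bilinear rules *)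

Section complex_differentiability.
Context {R : realType} {V : normedModType R[i]}.
Implicit Types (f : R[i] -> V) (z w : R[i]).

Definition cdiff f z (d : V) := forall e : R, 0 < e -> exists2 dl : R, 0 < dl &
  forall w, cabs (w - z) < dl ->
    rnorm (f w - f z - (w - z) *: d) <= e * cabs (w - z).

Definition ccont f z := forall e : R, 0 < e -> exists2 dl : R, 0 < dl &
  forall w, cabs (w - z) < dl -> rnorm (f w - f z) < e.

Lemma derivable_cdiff f z : derivable (f : R[i]^o -> V) z 1 ->
  cdiff f z ('D_1 (f : R[i]^o -> V) z).
Proof.
move=> df e e0; have eC : 0 < e%:C by rewrite ltcR.
have [[dl y] + H] := derivable_near df eC.
rewrite ltcE/= => /andP[/eqP y0 dl0]; rewrite y0 in H.
exists dl => // w wz; have := H w.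
by rewrite !normCE normVE -lecR rmorphM; apply; rewrite ltcR.
Qed.

Lemma cdiff_derivable f z d : cdiff f z d -> derivable (f : R[i]^o -> V) z 1.
Proof.
move=> H; apply: (@derivable_of_near _ _ _ _ d) => -[e y].
rewrite ltcE/= => /andP[/eqP -> e0]; have [dl dl0 {}H] := H _ e0.
exists dl%:C; first by rewrite ltcR.
by move=> w; rewrite !normCE normVE ltcR => /H; rewrite -lecR rmorphM.
Qed.

Lemma cdiff_ccont f z d : cdiff f z d -> ccont f z.
Proof.
move=> /(_ 1 ltr01)[dl dl0 H] e e0.
have n0 := rnorm_ge0 d; pose K := 1 + rnorm d.
have K0 : 0 < K by rewrite ltr_pwDl.
exists (Num.min dl (e / K)); first by rewrite lt_min dl0 divr_gt0.
move=> w; rewrite lt_min => /andP[/H H1]; rewrite ltr_pdivlMr// => H2.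
rewrite -(subrK ((w - z) *: d) (f w - f z)); apply: le_lt_trans (rnormD _ _) _.
apply: le_lt_trans H2; rewrite rnormZ /K mulrDr mulr1 lerD2r; lra.
Qed.

End complex_differentiability.


Lemma cdiff_comp_linear (R : realType) (V V' : normedModType R[i]) (L : V -> V')
    (C : R) (f : R[i] -> V) z d :
  {morph L : x y / x - y} -> (forall a, {morph L : x / a *: x}) ->
  (forall x, rnorm (L x) <= C * rnorm x) ->
  cdiff f z d -> cdiff (fun w => L (f w)) z (L d).
Proof.
move=> LB LZ LC Hf e e0; pose K := `|C| + 1.
have K0 : 0 < K by rewrite ltr_wpDl.
have [dl dl0 {}Hf] := Hf (e / K) (divr_gt0 e0 K0).
exists dl => // w /Hf H; rewrite -LZ -!LB.
apply: le_trans (LC _) _; apply: (@le_trans _ _ (K * rnorm (f w - f z - (w - z) *: d))).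
  by rewrite ler_wpM2r ?rnorm_ge0// (le_trans (ler_norm _))// lerDl.
rewrite mulrC -ler_pdivlMr//; apply: le_trans H _.
by rewrite mulrAC.
Qed.

Lemma cdiff_bilinear (R : realType) (V1 V2 V3 : normedModType R[i]) (B : V1 -> V2 -> V3)
    (C : R) (f : R[i] -> V1) (g : R[i] -> V2) z d d' :
  (forall y, {morph B^~ y : x x' / x - x'}) -> (forall x, {morph B x : y y' / y - y'}) ->
  (forall a y, {morph B^~ y : x / a *: x}) -> (forall a x, {morph B x : y / a *: y}) ->
  (forall x y, rnorm (B x y) <= C * (rnorm x * rnorm y)) ->
  cdiff f z d -> cdiff g z d' ->
  cdiff (fun w => B (f w) (g w)) z (B d (g z) + B (f z) d').
Proof.
move=> BlB BrB BlZ BrZ BC0 Hf Hg e e0; have gc := cdiff_ccont Hg.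
pose K := `|C| * (rnorm (g z) + 1 + rnorm d + rnorm (f z)) + 1.
have BC x y : rnorm (B x y) <= `|C| * (rnorm x * rnorm y).
  by apply: le_trans (BC0 _ _) _; rewrite ler_wpM2r ?ler_norm// mulr_ge0 ?rnorm_ge0.
have n1 := rnorm_ge0 (g z); have n2 := rnorm_ge0 d; have n3 := rnorm_ge0 (f z).
have K0 : 0 < K by rewrite ltr_wpDl// mulr_ge0// !addr_ge0.
have eK : 0 < e / K by rewrite divr_gt0.
have [a a0 {}Hf] := Hf _ eK; have [b b0 {}Hg] := Hg _ eK.
(* The bound 1 keeps [rnorm (g w)] below [rnorm (g z) + 1]; the bound [e / K] controls the cross
   term [B d (g w - g z)]. *)
have [c c0 Hc] := gc (Num.min 1 (e / K)) ltac:(by rewrite lt_min ltr01 eK).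
exists (Num.min a (Num.min b c)); first by rewrite !lt_min a0 b0.
move=> w; rewrite !lt_min => /and3P[/Hf H1 /Hg H2 /Hc].
rewrite lt_min => /andP[H3 H4].
(* Three errors: the first-order remainder of [f], the increment of [g] paired with the derivative
   of [f], and the first-order remainder of [g]. [K] collects their coefficients. *)
have -> : B (f w) (g w) - B (f z) (g z) - (w - z) *: (B d (g z) + B (f z) d') =
  B (f w - f z - (w - z) *: d) (g w) + (w - z) *: B d (g w - g z) +
  B (f z) (g w - g z - (w - z) *: d').
  rewrite !BlB !BrB !BlZ !BrZ scalerDr scalerBr.
  set x1 := B (f w) (g w); set x2 := B (f z) (g w); set x3 := _ *: B d (g w).
  set x4 := _ *: B d (g z); set x5 := B (f z) (g z); set x6 := _ *: B (f z) d'.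
  by rewrite opprD !addrA subrK [x1 - x2 - x4]addrAC subrK; congr (_ - _); rewrite addrAC.
have h0 := cabs_ge0 (w - z); set h := cabs (w - z) in h0 H1 H2 *.
set X := f w - f z - _ in H1 *; set Y := g w - g z - _ in H2 *; set Z := g w - g z in H3 H4 *.
have gw : rnorm (g w) <= rnorm (g z) + 1.
  rewrite -(subrK (g z) (g w)) -/Z addrC; apply: le_trans (rnormD _ _) _.
  by rewrite lerD2l ltW.
have E1 : rnorm (B X (g w)) <= `|C| * (e / K * h * (rnorm (g z) + 1)).
  apply: le_trans (BC _ _) _; rewrite ler_wpM2l//.
  by rewrite ler_pM ?rnorm_ge0.
have E2 : rnorm ((w - z) *: B d Z) <= `|C| * (e / K * h * rnorm d).
  rewrite rnormZ -/h; apply: (@le_trans _ _ (h * (`|C| * (rnorm d * (e / K))))).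
    rewrite ler_wpM2l//; apply: le_trans (BC _ _) _; rewrite ler_wpM2l//.
    by rewrite ler_wpM2l// ltW.
  by rewrite le_eqVlt; apply/orP; left; apply/eqP; ring.
have E3 : rnorm (B (f z) Y) <= `|C| * (e / K * h * rnorm (f z)).
  apply: le_trans (BC _ _) _; rewrite ler_wpM2l// mulrC.
  by rewrite ler_wpM2r.
apply: le_trans (rnormD _ _) _; apply: le_trans (lerD (rnormD _ _) (lexx _)) _.
apply: le_trans (lerD (lerD E1 E2) E3) _.
have -> : e * h = e / K * h * K by rewrite mulrAC divfK// gt_eqF.
have : 0 <= e / K * h by rewrite mulr_ge0// ltW.
set q := e / K * h => q0; have KE : K = `|C| * (rnorm (g z) + 1 + rnorm d + rnorm (f z)) + 1 by [].
apply: (@le_trans _ _ (q * (K - 1))); last by rewrite ler_wpM2l//; clear; lra.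
by rewrite KE le_eqVlt; apply/orP; left; apply/eqP; ring.
Qed.

(** * The unit circle parametrization and continuity along polar paths *)

Section cis.
Context {R : realType}.

Lemma is_derive_near (f : R -> R) (x d : R) : is_derive x 1 f d ->
  forall e, 0 < e -> exists2 dl, 0 < dl &
  forall t, `|t - x| < dl -> `|f t - f x - (t - x) * d| <= e * `|t - x|.
Proof. by move=> [df <-] e e0; exact: (derivable_near df e0). Qed.

Lemma cis_near (q e : R) : 0 < e -> exists2 dl : R, 0 < dl &
  forall t : R, `|t - q| < dl -> cabs (cis t - cis q - (t - q)%:C * ('i%C * cis q)) <= e * `|t - q|.
Proof.
move=> e0; have e2 : 0 < e / 2 by rewrite divr_gt0.
have [a a0 Ha] := is_derive_near (is_derive_cos q) e2.
have [b b0 Hb] := is_derive_near (is_derive_sin q) e2.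
exists (Num.min a b); first by rewrite lt_min a0.
move=> t; rewrite lt_min => /andP[/Ha {}Ha /Hb {}Hb].
apply: le_trans (cabs_le_ReIm _) _; rewrite /cis; simpc => /=.
apply: (@le_trans _ _ (e / 2 * `|t - q| + e / 2 * `|t - q|)); last by rewrite -mulrDl -splitr.
apply: lerD; [apply: le_trans Ha|apply: le_trans Hb].
  by rewrite le_eqVlt; apply/orP; left; apply/eqP; congr (`|_|); ring.
by rewrite le_eqVlt; apply/orP; left; apply/eqP; congr (`|_|); ring.
Qed.

Lemma lipschitz1 (f f' : R -> R) : (forall x : R, is_derive x 1 f (f' x)) ->
  (forall x, `|f' x| <= 1) -> forall s t, `|f s - f t| <= `|s - t|.
Proof.
move=> df f1.
have H s t : s <= t -> `|f t - f s| <= `|t - s|.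
  rewrite le_eqVlt => /predU1P[->|st]; first by rewrite !subrr.
  have [|c _ ->] := @MVT R f f' s t st (fun x _ => df x).
    apply: continuous_subspaceT => x; apply: differentiable_continuous.
    by apply/derivable1_diffP; case: (df x).
  by rewrite normrM ler_piMl.
by move=> s t; have [/H|/ltW/H//] := leP s t; rewrite distrC [`|t - s|]distrC.
Qed.

Lemma cis_lipschitz (s t : R) : cabs (cis s - cis t) <= 2 * `|s - t|.
Proof.
apply: le_trans (cabs_le_ReIm _) _; rewrite /cis; simpc => /=.
rewrite mulr2n mulrDl mul1r; apply: lerD.
  apply: (@lipschitz1 cos (fun x => - sin x)) => x.
  by rewrite normrN ler_norml sin_geN1 sin_le1.
apply: (@lipschitz1 sin cos) => x.
by rewrite ler_norml cos_geN1 cos_le1.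
Qed.

Lemma polar_lipschitz (r p s t : R) :
  cabs (r%:C * cis s - p%:C * cis t) <= `|r - p| + 2 * `|p| * `|s - t|.
Proof.
have -> : r%:C * cis s - p%:C * cis t = (r - p)%:C * cis s + p%:C * (cis s - cis t) :> R[i].
  by rewrite rmorphB mulrBl mulrBr addrA subrK.
apply: le_trans (cabsD _ _) _; rewrite !cabsM !cabsR cabs_cis mulr1 lerD2l.
have -> : 2 * `|p| * `|s - t| = `|p| * (2 * `|s - t|) by ring.
by apply: ler_wpM2l => //; exact: cis_lipschitz.
Qed.

Lemma eps_continuous (f : R -> R) x : (forall e, 0 < e -> exists2 dl, 0 < dl &
  forall t, `|t - x| < dl -> `|f t - f x| < e) -> {for x, continuous f}.
Proof.
move=> H; apply/cvgrPdist_lt => e /H[dl dl0 {}H].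
apply/nbhs_ballP; exists dl => //= t; rewrite /ball/= distrC => /H.
by rewrite distrC.
Qed.

End cis.

Section paths.
Context {R : realType} {V : normedModType R[i]}.

Definition pcont (u : R -> V) t0 := forall e : R, 0 < e -> exists2 dl : R, 0 < dl &
  forall t, `|t - t0| < dl -> rnorm (u t - u t0) < e.

Lemma ccont_path (f : R[i] -> V) (g : R -> R[i]) L t0 : ccont f (g t0) ->
  (forall t, cabs (g t - g t0) <= L * `|t - t0|) -> pcont (fun t => f (g t)) t0.
Proof.
move=> fc gL e e0; have [dl dl0 H] := fc _ e0.
pose K := `|L| + 1; have K0 : 0 < K by rewrite ltr_wpDl.
exists (dl / K); first by rewrite divr_gt0.
move=> t; rewrite ltr_pdivlMr// => tt; apply: H; apply: le_lt_trans (gL t) _.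
apply: le_lt_trans tt; rewrite mulrC ler_wpM2l// /K.
by apply: le_trans (ler_norm _) _; rewrite lerDl.
Qed.

Lemma pcont_rnorm (u : R -> V) t0 : pcont u t0 -> {for t0, continuous (fun t => rnorm (u t))}.
Proof.
move=> uc; apply: eps_continuous => e /uc[dl dl0 H]; exists dl => // t /H.
apply: le_lt_trans; rewrite ler_distl.
have h1 := rnormD (u t0) (u t - u t0); rewrite addrC subrK in h1.
have h2 := rnormD (u t) (u t0 - u t); rewrite addrC subrK [rnorm (u t0 - _)]rnormB in h2.
by rewrite lerBlDr h2 h1.
Qed.

End paths.

Section scalar_paths.
Context {R : realType}.

Lemma pcont_Re (u : R -> R[i]^o) t0 : pcont u t0 -> {for t0, continuous (fun t => complex.Re (u t))}.
Proof.
move=> uc; apply: eps_continuous => e /uc[dl dl0 H]; exists dl => // t /H.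
by apply: le_lt_trans; apply: le_trans (ler_Re_cabs _); rewrite raddfB.
Qed.

Lemma pcont_Im (u : R -> R[i]^o) t0 : pcont u t0 -> {for t0, continuous (fun t => complex.Im (u t))}.
Proof.
move=> uc; apply: eps_continuous => e /uc[dl dl0 H]; exists dl => // t /H.
by apply: le_lt_trans; apply: le_trans (ler_Im_cabs _); rewrite raddfB.
Qed.

Lemma polar_angle_lip (r t t0 : R) : cabs (r%:C * cis t - r%:C * cis t0) <= (2 * `|r|) * `|t - t0|.
Proof. by apply: le_trans (polar_lipschitz _ _ _ _) _; rewrite subrr normr0 add0r. Qed.

Lemma polar_radius_lip (r r0 t : R) : cabs (r%:C * cis t - r0%:C * cis t) <= 1 * `|r - r0|.
Proof. by apply: le_trans (polar_lipschitz _ _ _ _) _; rewrite subrr normr0 mulr0 addr0 mul1r. Qed.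

End scalar_paths.

(** * Mean value property and Poisson formula *)

Section goursat.
Context {R : realType}.

Definition circle_re (h : R[i] -> R[i]^o) (r : R) : R :=
  segint (fun t => complex.Re (h (r%:C * cis t))) 0 (2 * pi).

(** For [z1], [z2] the values of [h] at angles [c], [d], with [x1 = cis c], [x2 = cis d] and
    [l = d - c]: the deviation of the radial sides from their main term is a first-order remainder
    of [h] plus a first-order remainder of [cis] multiplied by the derivative [D].
    [goursat_re_identity] does the same for the circular sides. *)
Lemma goursat_im_identity (z1 z2 x1 x2 q D : R[i]) (r l : R) : 0 < r ->
  (complex.Im z1 - complex.Im z2) / r - (- complex.Re (D * q) * l) =
  complex.Im (z1 - z2 - (r%:C * x1 - r%:C * x2) * D) / r +
  complex.Im ((x1 - x2 + l%:C * ('i%C * q)) * D).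
Proof.
move=> r0; case: z1 z2 x1 x2 q D => ? ? [? ?] [? ?] [? ?] [? ?] [? ?].
by simpc => /=; field; rewrite gt_eqF.
Qed.

Lemma goursat_re_identity (z1 z2 x q D : R[i]) (a b : R) :
  complex.Re z1 - complex.Re z2 - complex.Re (D * q) * (b - a) =
  complex.Re (z1 - z2 - (b%:C * x - a%:C * x) * D) + complex.Re ((b - a)%:C * (x - q) * D).
Proof.
case: z1 z2 x q D => ? ? [? ?] [? ?] [? ?] [? ?].
by simpc => /=; ring.
Qed.

(* The closed form [h(w) dw / (i w)], with [w = r e^(i t)], has real part
   [Re h dt + Im h dr / r]; along the sides of a small rectangle its two
   contributions cancel to first order. *)
Lemma goursat_local (h : R[i] -> R[i]^o) (r1 r2 p q : R) (D : R[i]^o) :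
  0 < r1 -> r1 <= p -> p <= r2 -> cdiff h (p%:C * cis q) D -> forall e, 0 < e ->
  exists2 dl : R, 0 < dl & forall a b c d : R, r1 <= a -> a <= p -> p <= b -> b <= r2 ->
    c <= q -> q <= d -> b - a < dl -> d - c < dl ->
    (forall r, a <= r -> r <= b ->
      `|(complex.Im (h (r%:C * cis c)) - complex.Im (h (r%:C * cis d))) / r
         - (- complex.Re (D * cis q) * (d - c))| <= e * ((b - a) + (d - c))) /\
    (forall t, c <= t -> t <= d ->
      `|complex.Re (h (b%:C * cis t)) - complex.Re (h (a%:C * cis t))
         - complex.Re (D * cis q) * (b - a)| <= e * ((b - a) + (d - c))).
Proof.
move=> r10 r1p pr2 hD e e0.
have p0 : 0 < p := lt_le_trans r10 r1p.
have r20 : 0 < r2 := lt_le_trans p0 pr2.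
(* By [polar_lipschitz], [M s] bounds the distance from the base point to any point of the polar
   rectangle of half-perimeter [s]. *)
pose M := 1 + 2 * r2; have M0 : 0 < M by rewrite /M; lra.
(* The part [m <= r1] pays for the division by [r] on radial sides, and [m <= 1] serves the circular
   sides; [e1] then makes the remainder of a difference of two values at most [m / 2 * (e * s)]. *)
pose m := Num.min r1 1; have m0 : 0 < m by rewrite /m lt_min r10 ltr01.
have mr1 : m <= r1 by rewrite /m ge_min lexx.
have m1 : m <= 1 by rewrite /m ge_min lexx orbT.
pose e1 := e * m / (4 * M); have e10 : 0 < e1 by rewrite /e1 divr_gt0 ?mulr_gt0.
pose K := 1 + cabs D; have D0 := cabs_ge0 D; have K0 : 0 < K by rewrite /K; lra.
pose e2 := e / (2 * K); have e20 : 0 < e2 by rewrite /e2 divr_gt0// mulr_gt0.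
have [d1 d10 H1] := hD _ e10.
have [d2 d20 H2] := cis_near q e20.
exists (Num.min (Num.min d2 (d1 / (2 * M))) (e2 / 2)).
  by rewrite !lt_min d20 !divr_gt0 ?mulr_gt0.
move=> a b c d r1a ap pb br2 cq qd; rewrite !lt_min => /andP[/andP[ba2 ba1] bae] /andP[/andP[dc2 dc1] dce].
set s := (b - a) + (d - c).
have s0 : 0 <= s by rewrite /s; clear -ap pb cq qd; lra.
have polar r t : a <= r -> r <= b -> c <= t -> t <= d ->
    cabs (r%:C * cis t - p%:C * cis q) <= M * s.
  move=> ar rb ct td; apply: le_trans (polar_lipschitz _ _ _ _) _.
  rewrite (ger0_norm (ltW p0)).
  have h1 : `|r - p| <= b - a by rewrite ler_norml; apply/andP; split; clear -ar rb ap pb; lra.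
  have h2 : `|t - q| <= d - c by rewrite ler_norml; apply/andP; split; clear -ct td cq qd; lra.
  apply: (@le_trans _ _ ((b - a) + 2 * r2 * (d - c))).
    by apply: lerD => //; apply: ler_pM => //; clear -p0 pr2; lra.
  rewrite /M /s.
  have h3 : 0 <= r2 * (b - a) by rewrite mulr_ge0 ?(ltW r20)// subr_ge0 (le_trans ap).
  have h4 : 0 <= d - c by rewrite subr_ge0 (le_trans cq).
  by clear -h3 h4; lra.
have Ms : M * s < d1.
  rewrite -ltr_pdivlMl// mulrC /s.
  have -> : d1 / M = d1 / (2 * M) + d1 / (2 * M) by field; rewrite gt_eqF.
  exact: ltrD.
have near r t : a <= r -> r <= b -> c <= t -> t <= d ->
    cabs (h (r%:C * cis t) - h (p%:C * cis q) - (r%:C * cis t - p%:C * cis q) * D) <= e1 * (M * s).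
  move=> ar rb ct td; have hp := polar r t ar rb ct td.
  apply: le_trans (H1 _ (le_lt_trans hp Ms)) _.
  by rewrite ler_wpM2l// ltW.
have two r r' t t' : a <= r -> r <= b -> c <= t -> t <= d -> a <= r' -> r' <= b -> c <= t' -> t' <= d ->
    cabs (h (r%:C * cis t) - h (r'%:C * cis t') - (r%:C * cis t - r'%:C * cis t') * D) <= 2 * (e1 * (M * s)).
  move=> x1 x2 x3 x4 y1 y2 y3 y4.
  set A := h (p%:C * cis q); set z := p%:C * cis q in near *.
  have -> : h (r%:C * cis t) - h (r'%:C * cis t') - (r%:C * cis t - r'%:C * cis t') * D =
    (h (r%:C * cis t) - A - (r%:C * cis t - z) * D) - (h (r'%:C * cis t') - A - (r'%:C * cis t' - z) * D).
    by ring.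
  apply: le_trans (cabsD _ _) _; rewrite cabsN [2 * _]mulr_natl mulr2n.
  by apply: lerD; exact: near.
have ab := le_trans ap pb; have cd := le_trans cq qd.
have e1E : 2 * (e1 * (M * s)) = m / 2 * (e * s) by rewrite /e1; field; rewrite gt_eqF.
have es0 : 0 <= e * s by rewrite mulr_ge0// ltW.
split.
- move=> r ar rb; have r1r := le_trans r1a ar; have r0 := lt_le_trans r10 r1r.
  have rm := le_trans mr1 r1r.
  have T := two r r c d ar rb (lexx _) cd ar rb cd (lexx _).
  rewrite e1E in T.
  have C : cabs (cis c - cis d + (d - c)%:C * ('i%C * cis q)) <= e2 * s.
    have Hc := H2 c ltac:(rewrite ltr_norml; apply/andP; split; clear -cq qd dc2 d20; lra).
    have Hd := H2 d ltac:(rewrite ltr_norml; apply/andP; split; clear -cq qd dc2 d20; lra).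
    have -> : cis c - cis d + (d - c)%:C * ('i%C * cis q) =
       (cis c - cis q - (c - q)%:C * ('i%C * cis q)) - (cis d - cis q - (d - q)%:C * ('i%C * cis q)).
      by rewrite !rmorphB; ring.
    apply: le_trans (cabsD _ _) _; rewrite cabsN.
    apply: le_trans (lerD Hc Hd) _; rewrite -mulrDr ler_wpM2l ?(ltW e20)//.
    rewrite (@ler0_norm _ (c - q)) ?(@ger0_norm _ (d - q)) ?subr_le0 ?subr_ge0// /s.
    by clear -ab; lra.
  have E : (complex.Im (h (r%:C * cis c)) - complex.Im (h (r%:C * cis d))) / r
         - (- complex.Re (D * cis q) * (d - c)) =
    complex.Im (h (r%:C * cis c) - h (r%:C * cis d) - (r%:C * cis c - r%:C * cis d) * D) / r +
    complex.Im ((cis c - cis d + (d - c)%:C * ('i%C * cis q)) * D).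
    exact: goursat_im_identity.
  rewrite E; apply: le_trans (ler_normD _ _) _.
  have -> : e * s = e * s / 2 + e * s / 2 by clear; field.
  apply: lerD.
    rewrite normrM normfV (gtr0_norm r0) ler_pdivrMr//.
    apply: le_trans (ler_Im_cabs _) _; apply: le_trans T _.
    have : m * (e * s) <= r * (e * s) by rewrite ler_wpM2r.
    by clear; lra.
  apply: le_trans (ler_Im_cabs _) _; rewrite cabsM.
  apply: (@le_trans _ _ (e2 * s * K)).
    by apply: ler_pM => //; rewrite ?cabs_ge0// /K; clear; lra.
  by rewrite le_eqVlt; apply/orP; left; apply/eqP; rewrite /e2; field; rewrite gt_eqF.
- move=> t ct td.
  have T := two b a t t ab (lexx _) ct td (lexx _) ab ct td.
  rewrite e1E in T.
  have E : complex.Re (h (b%:C * cis t)) - complex.Re (h (a%:C * cis t))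
         - complex.Re (D * cis q) * (b - a) =
    complex.Re (h (b%:C * cis t) - h (a%:C * cis t) - (b%:C * cis t - a%:C * cis t) * D) +
    complex.Re ((b - a)%:C * (cis t - cis q) * D).
    exact: goursat_re_identity.
  rewrite E; apply: le_trans (ler_normD _ _) _.
  have -> : e * s = e * s / 2 + e * s / 2 by clear; field.
  apply: lerD.
    apply: le_trans (ler_Re_cabs _) _; apply: le_trans T _.
    have : m * (e * s) <= 1 * (e * s) by rewrite ler_wpM2r.
    by clear; lra.
  apply: le_trans (ler_Re_cabs _) _; rewrite !cabsM cabsR ger0_norm ?subr_ge0//.
  have L : cabs (cis t - cis q) <= e2.
    apply: le_trans (cis_lipschitz _ _) _.
    have : `|t - q| <= d - c by rewrite ler_norml; apply/andP; split; clear -ct td cq qd; lra.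
    by clear -dce; lra.
  apply: (@le_trans _ _ (s * e2 * K)).
    apply: ler_pM => //; rewrite ?mulr_ge0 ?cabs_ge0 ?subr_ge0//; last by rewrite /K; clear; lra.
    by apply: ler_pM; rewrite ?cabs_ge0 ?subr_ge0// /s; clear -cd; lra.
  by rewrite le_eqVlt; apply/orP; left; apply/eqP; rewrite /e2; field; rewrite gt_eqF.
Qed.

End goursat.

Section uniform_continuity_on_circles.
Context {R : realType} {V : normedModType R[i]}.

Lemma cabs_polar (r t : R) : cabs (r%:C * cis t) = `|r|.
Proof. by rewrite cabsM cabsR cabs_cis mulr1. Qed.

(** Compactness of the angle interval, with the radius as parameter: around each angle continuity at
    a single point controls both circles, and the covering property makes the radius neighbourhood
    uniform in [t]. *)
Lemma circle_unif_cont (f : R[i] -> V) (S r0 : R) : (forall w, cabs w < S -> ccont f w) -> `|r0| < S ->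
  forall e, 0 < e -> exists2 dl : R, 0 < dl & forall r, `|r - r0| < dl ->
    forall t, 0 <= t -> t <= 2 * pi -> rnorm (f (r%:C * cis t) - f (r0%:C * cis t)) < e.
Proof.
move=> fc r0S e e0.
have e2 : 0 < e / 2 by rewrite divr_gt0.
have /compact_near_coveringP nc := @segment_compact R 0 (2 * pi).
have : \forall r \near (r0 : R), `[0, 2 * pi] `<=`
    (fun t => rnorm (f (r%:C * cis t) - f (r0%:C * cis t)) < e).
  apply: (nc R (nbhs (r0 : R)) (fun r t => rnorm (f (r%:C * cis t) - f (r0%:C * cis t)) < e) _) => t _.
  have [dl dl0 H] := fc (r0%:C * cis t) ltac:(by rewrite cabs_polar) _ e2.
  pose M := 1 + 2 * `|r0|; have M0 : 0 < M by rewrite ltr_pwDl// mulr_ge0.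
  have dM : 0 < dl / M by rewrite divr_gt0.
  exists (ball t (dl / M), ball r0 (dl / M)).
    by split; exact: nbhsx_ballx.
  have near r t' : `|r - r0| < dl / M -> `|t' - t| < dl / M ->
      rnorm (f (r%:C * cis t') - f (r0%:C * cis t)) < e / 2.
    move=> rr tt; apply: H; apply: le_lt_trans (polar_lipschitz _ _ _ _) _.
    have -> : dl = dl / M + 2 * `|r0| * (dl / M).
      by rewrite -{1}[dl / M]mul1r -mulrDl -/M mulrC divfK// gt_eqF.
    by apply: ltr_leD => //; rewrite ler_wpM2l ?mulr_ge0// ltW.
  move=> [t' r] [/=]; rewrite /ball/= => tt' rr'.
  have -> : f (r%:C * cis t') - f (r0%:C * cis t') =
    (f (r%:C * cis t') - f (r0%:C * cis t)) - (f (r0%:C * cis t') - f (r0%:C * cis t)).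
    by rewrite opprB addrA subrK.
  apply: le_lt_trans (rnormD _ _) _; rewrite rnormN [e]splitr.
  by apply: ltrD; apply: near; rewrite ?subrr ?normr0// distrC.
move=> /nbhs_ballP[dl /= dl0 H]; exists dl => // r rr0 t t0 t2.
by apply: (H r); rewrite /ball/= ?in_itv/= ?t0// distrC.
Qed.

End uniform_continuity_on_circles.

Section mean_value.
Context {R : realType}.
Implicit Types (h : R[i] -> R[i]^o) (r s t : R).

Definition cdiffble h z := exists d, cdiff h z d.

Lemma cdiffble_ccont h z : cdiffble h z -> ccont h z.
Proof. by move=> [d]; exact: cdiff_ccont. Qed.

Lemma cont_angle h r : (forall t, ccont h (r%:C * cis t)) ->
  continuous (fun t => complex.Re (h (r%:C * cis t))).
Proof.
move=> hc t; apply: (@pcont_Re _ (fun t => h (r%:C * cis t))).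
by apply: (@ccont_path _ _ h (fun t => r%:C * cis t)) (hc t) _ => t'; exact: polar_angle_lip.
Qed.

(** The annulus is a rectangle in the [(r, t)] plane. Its sides [t = 0] and [t = 2 pi] carry the
    same values and cancel, so the vanishing of the boundary integral leaves the equality of the two
    circular integrals. *)
Lemma circle_re_const h r1 r2 : 0 < r1 -> r1 <= r2 ->
  (forall w, r1 <= cabs w -> cabs w <= r2 -> cdiffble h w) ->
  circle_re h r1 = circle_re h r2.
Proof.
move=> r10 r12 hd.
have hp r t : r1 <= r -> r <= r2 -> cdiffble h (r%:C * cis t).
  move=> h1 h2; apply: hd; rewrite cabs_polar ger0_norm//; exact: le_trans (ltW r10) h1.
have ca r a b : r1 <= r -> r <= r2 -> cont_on (fun t => complex.Re (h (r%:C * cis t))) a b.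
  move=> h1 h2 t _; apply: cont_angle => t'; apply: cdiffble_ccont; exact: hp.
have cr t a b : r1 <= a -> b <= r2 -> cont_on (fun r => complex.Im (h (r%:C * cis t))) a b.
  move=> h1 h2 r; rewrite in_itv/= => /andP[ar rb].
  apply: (@pcont_Im _ (fun r => h (r%:C * cis t))).
  apply: (@ccont_path _ _ h (fun r => r%:C * cis t)) => [|r']; last exact: polar_radius_lip.
  by apply/cdiffble_ccont/hp; [exact: le_trans ar|exact: le_trans h2].
have cinv a b : r1 <= a -> cont_on (fun r => r^-1) a b.
  move=> h1 r; rewrite in_itv/= => /andP[ar rb].
  by apply: inv_continuous; rewrite gt_eqF// (lt_le_trans r10)// (le_trans h1).
(* The positively oriented boundary integral of [Re h dt + Im h dr / r] in the [(r, t)] plane. *)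
pose J a b c d := segint (fun r => (complex.Im (h (r%:C * cis c)) - complex.Im (h (r%:C * cis d))) / r) a b
  + segint (fun t => complex.Re (h (b%:C * cis t)) - complex.Re (h (a%:C * cis t))) c d.
have cJ c d a b : r1 <= a -> b <= r2 ->
    cont_on (fun r => (complex.Im (h (r%:C * cis c)) - complex.Im (h (r%:C * cis d))) / r) a b.
  by move=> h1 h2; apply: cont_onM; [apply: cont_onB; exact: cr|exact: cinv].
have cK a b c d : r1 <= a -> a <= r2 -> r1 <= b -> b <= r2 ->
    cont_on (fun t => complex.Re (h (b%:C * cis t)) - complex.Re (h (a%:C * cis t))) c d.
  by move=> *; apply: cont_onB; exact: ca.
have pi0 : 0 <= 2 * pi :> R by rewrite mulr_ge0// pi_ge0.
have J0 : J r1 r2 0 (2 * pi) = 0.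
  apply: (@rect_additive_eq0 _ J) => //.
  - move=> a b c d m h1 h2 h3 h4 _ _ _; rewrite /J.
    have h12 := le_trans h1 h2; have h34 := le_trans h3 h4.
    have h23 := le_trans h2 h34; have h13 := le_trans h12 h3.
    rewrite (segint_split _ a b m (cJ c d a b h1 h4) h2 h3).
    rewrite addrACA -segintD; [|exact: cK..].
    by congr (_ + _); apply: eq_segint => t _ _; clear; ring.
  - move=> a b c d m h1 h2 h3 _ h4 h5 _; rewrite /J.
    have h12 := le_trans h1 h2; have h23 := le_trans h2 h3.
    rewrite (segint_split _ c d m (cK a b c d h1 h23 h12 h3) h4 h5) addrACA -segintD; [|exact: cJ..].
    by congr (_ + _); apply: eq_segint => r _ _; clear; ring.
  - move=> p q h1 h2 _ _ e e0.
    have [D HD] := hp p q h1 h2.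
    have [dl dl0 H] := goursat_local r10 h1 h2 HD e0.
    exists dl => // a b c d r1a ap pb br2 _ cq qd _ bal dcl.
    have [H1 H2] := H a b c d r1a ap pb br2 cq qd bal dcl.
    have ab := le_trans ap pb; have cd := le_trans cq qd.
    have r1b := le_trans r1a ab; have ar2 := le_trans ab br2.
    have E1 := segint_dist _ _ _ _ _ ab (cJ c d a b r1a br2) H1.
    have E2 := segint_dist _ _ _ _ _ cd (cK a b c d r1a ar2 r1b br2) H2.
    rewrite /J; move: E1 E2; set X := segint _ _ _; set Y := segint _ _ _.
    set k := complex.Re _; set u := b - a; set v := d - c => E1 E2.
    (* The main terms of the two pairs of sides are opposite; only remainders of second order
       survive. *)
    have -> : X + Y = (X - - k * v * u) + (Y - k * u * v) by ring.
    apply: le_trans (ler_normD _ _) _; apply: le_trans (lerD E1 E2) _.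
    by rewrite -mulrDr -mulrA -expr2.
move: J0; rewrite /J (eq_segint (fun=> 0)); last first.
  by move=> t _ _; rewrite -[2 * pi]add0r cis_periodic subrr mul0r.
rewrite segint_cst// mul0r add0r segintB; [|exact: ca..].
by move/eqP; rewrite subr_eq0 => /eqP.
Qed.

Lemma circle_re_cont h S r0 : (forall w, cabs w < S -> ccont h w) -> `|r0| < S ->
  forall e, 0 < e -> exists2 dl : R, 0 < dl & forall r, `|r - r0| < dl -> `|r| < S ->
    `|circle_re h r - circle_re h r0| <= e.
Proof.
move=> hc r0S e e0.
have p0 : 0 < 2 * pi :> R by rewrite mulr_gt0// pi_gt0.
pose e1 := e / (2 * pi); have e10 : 0 < e1 by rewrite divr_gt0.
have [dl dl0 H0] := circle_unif_cont hc r0S e10.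
exists dl => // r /H0 H rS.
have ca r' : `|r'| < S -> cont_on (fun t => complex.Re (h (r'%:C * cis t))) 0 (2 * pi).
  move=> r'S t _; apply: cont_angle => t'; apply: hc; by rewrite cabs_polar.
rewrite /circle_re -segintB; [|exact: ca..].
have := @segint_dist R (fun t =>
    complex.Re (h (r%:C * cis t)) - complex.Re (h (r0%:C * cis t))) 0 e1 0 (2 * pi) (ltW p0).
rewrite mul0r !subr0 /e1 divfK ?gt_eqF//; apply; first by apply: cont_onB; exact: ca.
move=> t t0 t2; rewrite subr0 -raddfB; apply: le_trans (ler_Re_cabs _) _.
by apply: ltW; exact: H.
Qed.

(** The disjunction in the last hypothesis keeps both radii on one side of [r0], so [m] is constant
    on each side. Continuity at 0 and at [r0] identifies the two constants with [m 0]. *)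
Lemma locally_const_eq0 (m : R -> R) (S r0 : R) : 0 < r0 ->
  (forall r, 0 <= r -> r < S -> forall e, 0 < e -> exists2 dl, 0 < dl &
     forall r', `|r' - r| < dl -> `|r'| < S -> `|m r' - m r| <= e) ->
  (forall r1 r2, 0 < r1 -> r1 <= r2 -> r2 < S -> (r2 < r0 \/ r0 < r1) -> m r1 = m r2) ->
  forall r, 0 <= r -> r < S -> m r = m 0.
Proof.
move=> r00 mc mk.
have left r a : 0 <= a -> a < r -> r <= r0 -> r < S ->
      (forall r', a < r' -> r' < r -> m r' = m 0) -> m r = m 0.
  move=> a0 ar rr0 rS H; apply/eqP; rewrite -subr_eq0 -normr_le0; apply/ler_addgt0Pr => e e0.
  have [dl dl0 Hd] := mc r ltac:(lra) rS e e0; rewrite add0r.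
  pose r' := Num.max ((a + r) / 2) (r - dl / 2).
  have h1 : a < r' by rewrite /r' lt_max; apply/orP; left; clear -ar; lra.
  have h2 : r' < r by rewrite /r' gt_max; apply/andP; split; clear -ar dl0; lra.
  have h3 : r - dl / 2 <= r' by rewrite /r' le_max lexx orbT.
  rewrite distrC -(H r' h1 h2); apply: Hd.
    by rewrite distrC ger0_norm; clear -h2 h3 dl0; lra.
  by rewrite ger0_norm; clear -h1 h2 a0 rS; lra.
have small r : 0 < r -> r < r0 -> r < S -> m r = m 0.
  move=> r0' rr0 rS; apply/eqP; rewrite -subr_eq0 -normr_le0; apply/ler_addgt0Pr => e e0.
  have [dl dl0 Hd] := mc 0 (lexx _) ltac:(lra) e e0; rewrite add0r.
  pose r' := Num.min r (dl / 2).
  have h1 : 0 < r' by rewrite /r' lt_min r0'/= divr_gt0.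
  have h2 : r' <= r by rewrite /r' ge_min lexx.
  have h3 : r' <= dl / 2 by rewrite /r' ge_min lexx orbT.
  rewrite -(mk r' r h1 h2 rS (or_introl rr0)); apply: Hd.
    by rewrite subr0 ger0_norm; clear -h1 h3 dl0; lra.
  by rewrite ger0_norm; clear -h1 h2 rS; lra.
have mid : r0 < S -> m r0 = m 0.
  move=> r0S; apply: (left r0 0) => // r' h1 h2; apply: small => //; exact: lt_trans r0S.
move=> r; rewrite le_eqVlt => /predU1P[<-//|r0' rS].
have [rr0|rr0|E] := ltgtP r r0; [exact: small| |by rewrite E mid// -E].
rewrite -mid; last exact: lt_trans rS.
apply/eqP; rewrite -subr_eq0 -normr_le0; apply/ler_addgt0Pr => e e0.
have [dl dl0 Hd] := mc r0 (ltW r00) ltac:(lra) e e0; rewrite add0r.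
pose r' := Num.min r (r0 + dl / 2).
have h1 : r0 < r' by rewrite /r' lt_min rr0/=; clear -dl0; lra.
have h2 : r' <= r by rewrite /r' ge_min lexx.
have h3 : r' <= r0 + dl / 2 by rewrite /r' ge_min lexx orbT.
rewrite -(mk r' r _ h2 rS (or_intror h1)); last by clear -h1 r00; lra.
apply: Hd.
  by rewrite ger0_norm; clear -h1 h3 dl0; lra.
by rewrite ger0_norm; clear -h1 h2 r00 rS; lra.
Qed.

(* On the circle [|w| = r0] only continuity is asked, to allow for the removable
   singularity of a difference quotient. *)
Lemma mean_value h S r0 : 0 < r0 -> (forall w, cabs w < S -> ccont h w) ->
  (forall w, cabs w < S -> w != 0 -> cabs w != r0 -> cdiffble h w) ->
  forall r, 0 <= r -> r < S -> circle_re h r = 2 * pi * complex.Re (h 0).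
Proof.
move=> r00 hc hd r rge0 rS; rewrite (@locally_const_eq0 (circle_re h) S r0)//.
- rewrite /circle_re (eq_segint (fun=> complex.Re (h 0))); last by move=> t _ _; rewrite mul0r.
  by rewrite segint_cst ?mulr_ge0 ?pi_ge0// subr0 mulrC.
- move=> s s0 sS e e0; apply: circle_re_cont => //; by rewrite ger0_norm.
- move=> r1 r2 r10 r12 r2S rr; apply: circle_re_const => // w w1 w2.
  apply: hd; first exact: le_lt_trans r2S.
    by rewrite -cabs_eq0 gt_eqF// (lt_le_trans r10).
  by case: rr => rr; [rewrite lt_eqF// (le_lt_trans w2)|rewrite gt_eqF// (lt_le_trans rr)].
Qed.

Lemma cdiff_eq_near h k z d dl : 0 < dl -> (forall w, cabs (w - z) < dl -> h w = k w) ->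
  cdiff h z d -> cdiff k z d.
Proof.
move=> dl0 hk H e e0; have [a a0 {}H] := H e e0; exists (Num.min dl a); first by rewrite lt_min dl0.
move=> w; rewrite lt_min => /andP[w1 w2]; rewrite -!hk//; first exact: H.
by rewrite subrr cabs0.
Qed.

Lemma cdiffbleP h z : cdiffble h z <-> derivable (h : R[i]^o -> R[i]^o) z 1.
Proof. by split=> [[d /cdiff_derivable]//|/derivable_cdiff ?]; exists ('D_1 (h : R[i]^o -> R[i]^o) z). Qed.

Lemma cdiffbleM h k z : cdiffble h z -> cdiffble k z -> cdiffble (fun w => h w * k w : R[i]^o) z.
Proof. by move=> /cdiffbleP h1 /cdiffbleP h2; apply/cdiffbleP; exact (derivableM h1 h2). Qed.

Lemma cdiffbleB h k z : cdiffble h z -> cdiffble k z -> cdiffble (fun w => h w - k w : R[i]^o) z.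
Proof. by move=> /cdiffbleP h1 /cdiffbleP h2; apply/cdiffbleP; exact (derivableB h1 h2). Qed.

Lemma cdiffbleV h z : h z != 0 -> cdiffble h z -> cdiffble (fun w => (h w)^-1 : R[i]^o) z.
Proof. by move=> h0 /cdiffbleP h1; apply/cdiffbleP; exact (derivableV h0 h1). Qed.

Lemma cdiffble_cst (c : R[i]^o) z : cdiffble (fun=> c) z.
Proof. by apply/cdiffbleP; apply derivable_cst. Qed.

Lemma cdiffble_id z : cdiffble (fun w => w : R[i]^o) z.
Proof. by apply/cdiffbleP; apply derivable_id. Qed.

End mean_value.

Section poisson.
Context {R : realType}.
Implicit Types (r s t rho tau : R).

(** Normalized without the factor [1 / (2 pi)]: its integral over a period is [2 pi]. The
    denominator is [|1 - rho e^(i tau)|^2]. *)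
Definition poisson (rho tau : R) : R := (1 - rho ^+ 2) / (1 - 2 * rho * cos tau + rho ^+ 2).

Lemma poisson_den_ge rho tau : 0 <= rho -> (1 - rho) ^+ 2 <= 1 - 2 * rho * cos tau + rho ^+ 2.
Proof.
move=> r0; have : rho * cos tau <= rho * 1 by rewrite ler_wpM2l// cos_le1.
by lra.
Qed.

Lemma poisson_den_gt0 rho tau : 0 <= rho -> rho < 1 -> 0 < 1 - 2 * rho * cos tau + rho ^+ 2.
Proof.
move=> r0 r1; apply: lt_le_trans (poisson_den_ge tau r0).
by rewrite exprn_gt0// subr_gt0.
Qed.

Lemma poisson_ge0 rho tau : 0 <= rho -> rho < 1 -> 0 <= poisson rho tau.
Proof.
move=> r0 r1; rewrite divr_ge0//; last by apply/ltW/poisson_den_gt0.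
by rewrite subr_ge0 expr_le1// ltW.
Qed.

Lemma poisson_cont rho : 0 <= rho -> rho < 1 -> continuous (poisson rho).
Proof.
move=> r0 r1 t; apply: cvgM; first exact: cvg_cst.
apply: cvgV; first by rewrite gt_eqF// poisson_den_gt0.
apply: cvgD; last exact: cvg_cst.
apply: cvgB; first exact: cvg_cst.
by apply: cvgM; [exact: cvg_cst|exact: continuous_cos].
Qed.

Lemma cabs_sub_cis rho tau : cabs (1 - rho%:C * cis tau) ^+ 2 = 1 - 2 * rho * cos tau + rho ^+ 2.
Proof.
rewrite cabsE sqr_sqrtr ?addr_ge0 ?sqr_ge0// /cis; simpc => /=.
have E : sin tau ^+ 2 = 1 - cos tau ^+ 2 by have := cos2Dsin2 tau; lra.
by rewrite ?sqrrN !exprMn E; ring.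
Qed.

(* With [D] the derivative of [H] at [z], the value at [z] is that of the
   continuous extension. *)
Definition cauchy_quot (H : R[i] -> R[i]^o) (z D : R[i]) : R[i] -> R[i]^o :=
  fun w => if w == z then z * D else (H w - H z) * (w / (w - z)).

Lemma cdiff_quotient_cont (H : R[i] -> R[i]^o) (z : R[i]) (D : R[i]^o) : cdiff H z D ->
  ccont (cauchy_quot H z D) z.
Proof.
move=> HD e e0; pose K := cabs z + 1 + cabs D.
have z0 := cabs_ge0 z; have D0 := cabs_ge0 D.
have K0 : 0 < K by rewrite /K; clear -z0 D0; lra.
have eK : 0 < e / (2 * K) by rewrite divr_gt0// mulr_gt0.
have [dl dl0 {}HD] := HD _ eK.
exists (Num.min dl (Num.min 1 (e / (2 * K)))).
  by rewrite !lt_min dl0 ltr01 eK.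
move=> w; rewrite !lt_min => /and3P[/HD Hw w1 we].
rewrite /cauchy_quot eqxx; have [_|wz] := eqVneq w z; first by rewrite subrr rnorm0.
have wz0 : w - z != 0 by rewrite subr_eq0.
have c0 : 0 < cabs (w - z) by rewrite lt_neqAle cabs_ge0 eq_sym cabs_eq0 wz0.
(* Since [w D - z D = (w - z) D], what remains is the difference quotient error times [w], plus a
   term of size [|w - z|]. *)
have -> : (H w - H z) * (w / (w - z)) - z * D =
  (H w - H z - (w - z) * D) / (w - z) * w + (w - z) * D.
  by field.
have E1 : cabs ((H w - H z - (w - z) * D) / (w - z) * w) <= e / (2 * K) * (cabs z + 1).
  rewrite !cabsM cabsV; apply: ler_pM; rewrite ?mulr_ge0 ?invr_ge0 ?cabs_ge0//.
    by rewrite ler_pdivrMr.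
  rewrite -{1}(subrK z w) addrC; apply: le_trans (cabsD _ _) _.
  by rewrite lerD2l ltW.
have E2 : cabs ((w - z) * D) <= e / (2 * K) * cabs D.
  by rewrite cabsM ler_wpM2r// ltW.
apply: le_lt_trans (cabsD _ _) _; apply: le_lt_trans (lerD E1 E2) _.
rewrite -mulrDr -/K.
have -> : e / (2 * K) * K = e / 2 by field; rewrite gt_eqF.
by clear -e0; lra.
Qed.

Lemma conj_1BM (c w : R[i]) : (1 - c * w)^*%C = 1 - c^*%C * w^*%C.
Proof. by case: c w => ? ? [? ?]; simpc. Qed.

Lemma conj_divR (z : R[i]) (a : R) : (z^*%C / a%:C)^*%C = z / a%:C.
Proof. by rewrite -fmorphV; case: z => ? ?; simpc. Qed.

(** Follows from [Re (c conj(b)) = Re (conj(c) b)]. Read with [a = G(w)], [b = k(w)], [c = H(z)]: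
    the two terms on the right are the Cauchy quotient of [H = G k] and a multiple of [k] alone,
    each accessible to the mean value property. *)
Lemma szego_identity (a b c : R[i]) :
  complex.Re a * cabs b ^+ 2 = complex.Re ((a * b - c) * b^*%C) + complex.Re (c^*%C * b).
Proof.
rewrite cabsE sqr_sqrtr ?addr_ge0 ?sqr_ge0//.
by case: a b c => ? ? [? ?] [? ?]; simpc => /=; ring.
Qed.

(* Cauchy's formula at [z] for [G k], where [k(w) = 1 / (1 - conj(z) w / s^2)]:
   on the circle [|w| = s] the Cauchy kernel [w / (w - z)] is the conjugate of
   [k(w)], and [|k|^2] is a multiple of the Poisson kernel. *)
Lemma poisson_formula (G : R[i] -> R[i]^o) (S r s t0 : R) :
  (forall w, cabs w < S -> cdiffble G w) -> 0 <= r -> r < s -> s < S ->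
  segint (fun t => complex.Re (G (s%:C * cis t)) * poisson (r / s) (t - t0)) 0 (2 * pi) =
  2 * pi * complex.Re (G (r%:C * cis t0)).
Proof.
(* For [r = 0] the kernel is 1 and the claim is the mean value property; the exceptional radius 1
   passed there is arbitrary. *)
move=> dG; rewrite le_eqVlt => /predU1P[<-|r0] rs sS.
  have -> : 0%:C * cis t0 = 0 by rewrite mul0r.
  rewrite -(@mean_value R G S 1 ltr01 _ _ s (ltW rs) sS); last 2 first.
  - by move=> w /dG; exact: cdiffble_ccont.
  - by move=> w /dG.
  apply: eq_segint => t _ _; rewrite /poisson mul0r mulr0 mul0r subr0 expr0n/=.
  by rewrite !(subr0, addr0) divr1 mulr1.
have s0 : 0 < s := lt_trans r0 rs.
pose z := r%:C * cis t0; pose c := z^*%C / (s ^+ 2)%:C.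
have cz : cabs z = r by rewrite /z cabs_polar gtr0_norm.
have cc : cabs c = r / s ^+ 2.
  by rewrite /c cabsM cabsV cabs_conj cz cabsR ger0_norm// sqr_ge0.
(* The pole of [k], where [c w = 1], has modulus [s^2 / r > s]; below [S'] both [G] and [k] are
   differentiable. *)
pose S' := Num.min S (s ^+ 2 / r).
have sS' : s < S' by rewrite /S' lt_min sS/= ltr_pdivlMr// expr2 ltr_pM2l.
have k0 w : cabs w < S' -> 1 - c * w != 0.
  rewrite /S' lt_min => /andP[_ wS]; apply: contraTneq wS => /eqP.
  rewrite subr_eq0 => /eqP cw; rewrite -leNgt.
  have := congr1 cabs cw; rewrite cabs1 cabsM cc => E.
  rewrite ler_pdivrMr// le_eqVlt; apply/orP; left; apply/eqP.
  rewrite -[LHS]mulr1 E; field; rewrite gt_eqF//.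
pose k w : R[i]^o := (1 - c * w)^-1.
have dk w : cabs w < S' -> cdiffble k w.
  move=> wS; apply: (@cdiffbleV _ (fun w => 1 - c * w)); first exact: k0.
  apply: cdiffbleB; first exact: cdiffble_cst.
  by apply: cdiffbleM; [exact: cdiffble_cst|exact: cdiffble_id].
pose H w : R[i]^o := G w * k w.
have dH w : cabs w < S' -> cdiffble H w.
  move=> wS; apply: cdiffbleM; last exact: dk.
  by apply: dG; apply: lt_le_trans wS _; rewrite /S' ge_min lexx.
have zS' : cabs z < S' by rewrite cz (lt_trans rs).
have z0 : z != 0 by rewrite -cabs_eq0 cz gt_eqF.
have [D HD] := dH z zS'.
pose h := cauchy_quot H z D.
have dh w : cabs w < S' -> w != z -> cdiffble h w.
  move=> wS wz.
  have : cdiffble (fun w => (H w - H z) * (w * (w - z)^-1) : R[i]^o) w.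
    apply: cdiffbleM; first by apply: cdiffbleB; [exact: dH|exact: cdiffble_cst].
    apply: cdiffbleM; first exact: cdiffble_id.
    apply: (@cdiffbleV _ (fun w => w - z)); first by rewrite subr_eq0.
    by apply: cdiffbleB; [exact: cdiffble_id|exact: cdiffble_cst].
  case=> d Hd; exists d; have wz0 : 0 < cabs (w - z).
    by rewrite lt_neqAle cabs_ge0 eq_sym cabs_eq0 subr_eq0 wz.
  apply: (cdiff_eq_near wz0) Hd => w' w'w; rewrite /h /cauchy_quot.
  by have [w'z|//] := eqVneq w' z; rewrite w'z cabsB ltxx in w'w.
have ch w : cabs w < S' -> ccont h w.
  move=> wS; have [->|wz] := eqVneq w z; last by apply/cdiffble_ccont/dh.
  exact: cdiff_quotient_cont.
(* The factor [w] of the quotient vanishes at the centre. The exceptional circle is [|w| = r], which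
   contains the removable singularity [z]. *)
have Eh : circle_re h s = 0.
  rewrite (@mean_value R h S' r r0 ch _ s (ltW s0) sS').
    by rewrite /h /cauchy_quot eq_sym (negbTE z0) mul0r mulr0 mulr0.
  by move=> w wS _ wr; apply: dh => //; apply: contraNneq wr => ->; rewrite cz.
have Ek : circle_re (fun w => (H z)^*%C * k w) s = 2 * pi * complex.Re (H z).
  rewrite (@mean_value R _ S' 1 ltr01 _ _ s (ltW s0) sS').
  - by rewrite /k mulr0 subr0 invr1 mulr1; case: (H z).
  - by move=> w wS; apply/cdiffble_ccont/cdiffbleM; [exact: cdiffble_cst|exact: dk].
  - by move=> w wS _ _; apply: cdiffbleM; [exact: cdiffble_cst|exact: dk].
have rs1 : r / s < 1 by rewrite ltr_pdivrMr// mul1r.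
have rs0 : 0 <= r / s by rewrite divr_ge0// ltW.
have s2C : (s ^+ 2)%:C != 0 :> R[i] by rewrite fmorph_eq0 expf_neq0// gt_eqF.
have cw t : c * (s%:C * cis t) = (r / s)%:C * cis (t - t0).
  have zc : z^*%C = r%:C * cis (- t0) by rewrite /z /cis cosN sinN; simpc.
  rewrite /c zc [t - t0]addrC cisD.
  have -> : (r / s)%:C = r%:C * s%:C / (s ^+ 2)%:C.
    by rewrite -rmorphM -fmorphV -rmorphM; congr (_%:C); field; rewrite gt_eqF.
  by ring.
have cw_z : c * z = ((r / s) ^+ 2)%:C.
  rewrite /c mulrAC [z^*%C * z]mulrC -sqr_normc normCE cz.
  by rewrite expr_div_n -rmorphXn fmorph_div.
have q0 : 1 - (r / s) ^+ 2 != 0.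
  by rewrite gt_eqF// subr_gt0 expr_lt1.
(* As [c z = (r / s)^2] is real, [k(z)] is the inverse of exactly the numerator that turns [|k|^2]
   into the Poisson kernel. *)
have Hz : complex.Re (H z) = complex.Re (G z) / (1 - (r / s) ^+ 2).
  have -> : H z = G z * ((1 - (r / s) ^+ 2)^-1)%:C.
    rewrite /H /k; congr (_ * _); rewrite fmorphV; congr (_^-1).
    by rewrite cw_z rmorphB rmorph1.
  by case: (G z) => a b; simpc.
have key t : complex.Re (G (s%:C * cis t)) * poisson (r / s) (t - t0) =
   (1 - (r / s) ^+ 2) * (complex.Re (h (s%:C * cis t)) + complex.Re ((H z)^*%C * k (s%:C * cis t))).
  set w := s%:C * cis t.
  have cw0 : cabs w = s by rewrite cabs_polar gtr0_norm.
  have wz : w != z by apply: contraTneq rs => wz; rewrite -cz -wz cw0 ltxx.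
  have wS : cabs w < S' by rewrite cw0.
  have w0 : w != 0 by rewrite -cabs_eq0 cw0 gt_eqF.
  (* Here [w conj(w) = s^2] is used: it holds on the circle of radius [s] only. *)
  have hE : w / (w - z) = (k w)^*%C.
    have E : (1 - c * w)^*%C * w = w - z.
      rewrite conj_1BM /c conj_divR mulrBl mul1r; congr (_ - _).
      have -> : z / (s ^+ 2)%:C * w^*%C * w = z * (w * w^*%C) / (s ^+ 2)%:C by ring.
      by rewrite -sqr_normc normCE cw0 -rmorphXn mulfK.
    by rewrite /k conjc_inv -E invfM mulrCA mulfV// mulr1.
  have PE : poisson (r / s) (t - t0) = (1 - (r / s) ^+ 2) * cabs (k w) ^+ 2.
    by rewrite /poisson /k cabsV exprVn /w cw cabs_sub_cis.
  rewrite PE mulrCA; congr (_ * _).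
  rewrite /h /cauchy_quot (negbTE wz) hE /H.
  exact: szego_identity.
rewrite (eq_segint _ _ _ _ (fun t _ _ => key t)).
have c1 : cont_on (fun t => complex.Re (h (s%:C * cis t))) 0 (2 * pi).
  by move=> t _; apply: cont_angle => t'; apply: ch; rewrite cabs_polar gtr0_norm.
have c2 : cont_on (fun t => complex.Re ((H z)^*%C * k (s%:C * cis t))) 0 (2 * pi).
  move=> t _; apply: (@cont_angle _ (fun w => (H z)^*%C * k w)) => t'.
  apply/cdiffble_ccont/cdiffbleM; first exact: cdiffble_cst.
  by apply: dk; rewrite cabs_polar gtr0_norm.
rewrite segintZ; last exact: cont_onD.
rewrite segintD//; rewrite /circle_re in Eh Ek; rewrite Eh Ek add0r Hz.
by rewrite mulrCA [X in _ * X = _]mulrC divfK.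
Qed.

End poisson.

Lemma sqrD_identity (R : realType) (p q : R) (d : R[i]) :
  p%:C + d + (d^*%C + q%:C) = (p + q + 2 * complex.Re d)%:C.
Proof.
by case: d => a b; apply/eqP; rewrite eq_complex /=; apply/andP; split; apply/eqP; ring.
Qed.

Lemma Re_proj_identity (R : realType) (d : R[i]) (n : R) :
  complex.Re ((d / n%:C)^*%C * d) = cabs d ^+ 2 / n.
Proof.
rewrite cabsE sqr_sqrtr ?addr_ge0 ?sqr_ge0// -fmorphV.
by case: d => a b; simpc => /=; ring.
Qed.

Section hilbert_theory.
Context {R : realType} {E : hilbert R}.
Implicit Types (x y : E).

Lemma dotp_conj x y : dotp E x y = (dotp E y x)^*%C.
Proof. by rewrite (hermC (dotp E)) expr0 mul1r. Qed.

Lemma dotpZl c x y : dotp E (c *: x) y = c * dotp E x y.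
Proof. exact: linearZl_LR. Qed.

Lemma dotpZr c x y : dotp E x (c *: y) = c^*%C * dotp E x y.
Proof. exact: linearZr_LR. Qed.

Lemma dotp_rnorm x : dotp E x x = (rnorm x ^+ 2)%:C.
Proof. by rewrite dotpE normVE rmorphXn. Qed.

Lemma rnorm_sqrD x y : rnorm (x + y) ^+ 2 =
  rnorm x ^+ 2 + rnorm y ^+ 2 + 2 * complex.Re (dotp E x y).
Proof.
apply: (@complexI R); rewrite -dotp_rnorm linearDl !linearDr/= !dotp_rnorm.
by rewrite (dotp_conj y x); exact: sqrD_identity.
Qed.

Lemma rnorm_sqrB x y : rnorm (x - y) ^+ 2 =
  rnorm x ^+ 2 + rnorm y ^+ 2 - 2 * complex.Re (dotp E x y).
Proof. by rewrite rnorm_sqrD rnormN linearNr raddfN/= mulrN. Qed.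

Lemma parallelogram x y : rnorm (x + y) ^+ 2 + rnorm (x - y) ^+ 2 = 2 * rnorm x ^+ 2 + 2 * rnorm y ^+ 2.
Proof. by rewrite rnorm_sqrD rnorm_sqrB; ring. Qed.

Lemma Re_dotp_le x y : 2 * complex.Re (dotp E x y) <= rnorm x ^+ 2 + rnorm y ^+ 2.
Proof. by have := sqr_ge0 (rnorm (x - y)); rewrite rnorm_sqrB subr_ge0. Qed.

(** Cauchy-Schwarz, from the nonnegativity of [|x - c y|^2] at [c = <x, y> / |y|^2]. *)
Lemma cabs_dotp_le x y : cabs (dotp E x y) <= rnorm x * rnorm y.
Proof.
have [->|y0] := eqVneq y 0.
  by rewrite linear0r/= cabs0 rnorm0 mulr0.
pose n := rnorm y; have n0 : 0 < n by rewrite lt_neqAle rnorm_ge0 eq_sym rnorm_eq0 y0.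
pose d := dotp E x y; pose c := d / (n ^+ 2)%:C.
have := sqr_ge0 (rnorm (x - c *: y)).
rewrite rnorm_sqrB rnormZ dotpZr -/d.
have -> : complex.Re (c^*%C * d) = cabs d ^+ 2 / n ^+ 2.
  exact: Re_proj_identity.
have -> : cabs c = cabs d / n ^+ 2.
  by rewrite /c cabsM cabsV cabsR ger0_norm ?sqr_ge0.
rewrite -/n => h.
have : cabs d ^+ 2 <= (rnorm x * n) ^+ 2.
  rewrite exprMn -ler_pdivrMr ?exprn_gt0//.
  have E1 : (cabs d / n ^+ 2 * n) ^+ 2 = cabs d ^+ 2 / n ^+ 2 by field; rewrite gt_eqF.
  rewrite E1 in h; lra.
by rewrite ler_pXn2r ?nnegrE ?cabs_ge0 ?mulr_ge0 ?rnorm_ge0.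
Qed.

End hilbert_theory.

(** * The maximal inequality *)

Section poisson_inequality.
Context {R : realType} {E : hilbert R}.
Implicit Types (f : R[i] -> E) (r s t : R).

Definition sqn f r t : R := rnorm (f (r%:C * cis t)) ^+ 2.

Lemma sqn_ge0 f r t : 0 <= sqn f r t.
Proof. exact: sqr_ge0. Qed.

Lemma sqn_periodic f r t : sqn f r (t + 2 * pi) = sqn f r t.
Proof. by rewrite /sqn cis_periodic. Qed.

Definition hol f (S : R) := forall w, cabs w < S -> exists d, cdiff f w d.

Lemma hol_ccont f S w : hol f S -> cabs w < S -> ccont f w.
Proof. by move=> fS /fS[d]; exact: cdiff_ccont. Qed.

Lemma sqn_cont f S r : hol f S -> `|r| < S -> continuous (sqn f r).
Proof.
move=> fS rS t; have c : {for t, continuous (fun t => rnorm (f (r%:C * cis t)))}.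
  apply: (@pcont_rnorm _ _ (fun t => f (r%:C * cis t))).
  apply: (@ccont_path _ _ f (fun t => r%:C * cis t)); last by move=> t'; exact: polar_angle_lip.
  by apply: hol_ccont fS _; rewrite cabs_polar.
pose n t' := rnorm (f (r%:C * cis t')).
have -> : sqn f r = (fun t' => n t' * n t') by apply/funext => t'; rewrite /sqn expr2.
by apply: cvgM; exact: c.
Qed.

Lemma cdiff_dotp f w d e : cdiff f w d -> cdiff (fun w => dotp E (f w) e : R[i]^o) w (dotp E d e).
Proof.
apply: (@cdiff_comp_linear R E (R[i]^o : normedModType R[i]) (fun x => dotp E x e) (rnorm e)).
- by move=> x y; exact: linearBl.
- by move=> a x; exact: dotpZl.
- by move=> x; rewrite mulrC; exact: cabs_dotp_le.
Qed.

Lemma poisson_shift_cont r s t0 : 0 <= r -> r < s -> continuous (fun t => poisson (r / s) (t - t0)).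
Proof.
move=> r0 rs t; have s0 := le_lt_trans r0 rs.
apply: (@continuous_comp _ _ _ (fun t => t - t0) (poisson (r / s))).
  by apply: cvgB; [exact: cvg_id|exact: cvg_cst].
apply: poisson_cont; first by rewrite divr_ge0// ltW.
by rewrite ltr_pdivrMr// mul1r.
Qed.

Lemma int_poisson r s t0 : 0 <= r -> r < s ->
  segint (fun t => poisson (r / s) (t - t0)) 0 (2 * pi) = 2 * pi.
Proof.
move=> r0 rs; have s0 := le_lt_trans r0 rs.
have := @poisson_formula R (fun=> 1) (s + 1) r s t0 _ r0 rs _.
rewrite mulr1 => int1; rewrite -[RHS]int1.
- by apply: eq_segint => t _ _; rewrite mul1r.
- by move=> w _; exact: cdiffble_cst.
- by rewrite ltrDl.
Qed.

(** With [e = f(z)], the bound [2 Re <f, e> <= |f|^2 + |e|^2] is averaged against the kernel. Its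
    total mass [2 pi] makes the [|e|^2] term half of the left side, so it is absorbed. *)
Lemma poisson_ineq f S r s t0 : hol f S -> 0 <= r -> r < s -> s < S ->
  2 * pi * sqn f r t0 <= segint (fun t => sqn f s t * poisson (r / s) (t - t0)) 0 (2 * pi).
Proof.
move=> fS r0 rs sS; have s0 := le_lt_trans r0 rs.
set e := f (r%:C * cis t0).
pose G w : R[i]^o := dotp E (f w) e.
have dG w : cabs w < S -> cdiffble G w.
  by move=> /fS[d Hd]; exists (dotp E d e); exact: cdiff_dotp.
have P0 t : 0 <= poisson (r / s) (t - t0).
  by apply: poisson_ge0; [rewrite divr_ge0// ltW|rewrite ltr_pdivrMr// mul1r].
have cP : cont_on (fun t => poisson (r / s) (t - t0)) 0 (2 * pi).
  by move=> t _; exact: poisson_shift_cont.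
have cs : cont_on (sqn f s) 0 (2 * pi).
  by move=> t _; apply: (sqn_cont fS); rewrite gtr0_norm.
have cG : cont_on (fun t => complex.Re (G (s%:C * cis t))) 0 (2 * pi).
  move=> t _; apply: cont_angle => t'; apply/cdiffble_ccont/dG.
  by rewrite cabs_polar gtr0_norm.
have := @poisson_formula R G S r s t0 dG r0 rs sS.
rewrite {2}/G -/e dotp_rnorm /= => EG.
have : segint (fun t => complex.Re (G (s%:C * cis t)) * poisson (r / s) (t - t0)) 0 (2 * pi) <=
  segint (fun t =>
      2^-1 * (sqn f s t * poisson (r / s) (t - t0)) + (2^-1 * rnorm e ^+ 2) * poisson (r / s) (t - t0)) 0 (2 * pi).
  apply: segint_le.
  - exact: cont_onM.
  - apply: cont_onD; apply: cont_onM => //; try exact: cont_on_cst.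
    exact: cont_onM.
  - move=> t _ _; set P := poisson _ _.
    have -> : 2^-1 * (sqn f s t * P) + 2^-1 * rnorm e ^+ 2 * P =
      2^-1 * (sqn f s t + rnorm e ^+ 2) * P by ring.
    rewrite ler_wpM2r ?P0// /sqn; have := Re_dotp_le (f (s%:C * cis t)) e; rewrite -/(G _); lra.
rewrite EG segintD; last 2 first.
- by apply: cont_onM; [exact: cont_on_cst|exact: cont_onM].
- by apply: cont_onM => //; exact: cont_on_cst.
rewrite (segintZ 2^-1); last exact: cont_onM.
rewrite (segintZ (2^-1 * rnorm e ^+ 2))//.
rewrite int_poisson// /sqn -/e; lra.
Qed.

End poisson_inequality.

Section radially_decreasing_kernel.
Context {R : realType}.
Implicit Types (q v : R -> R) (r s t rho tau : R).

Definition dpoisson rho tau : R :=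
  - ((1 - rho ^+ 2) * (2 * rho * sin tau)) / (1 - 2 * rho * cos tau + rho ^+ 2) ^+ 2.

Lemma is_derive_poisson rho tau : 0 <= rho -> rho < 1 ->
  is_derive tau 1 (poisson rho) (dpoisson rho tau).
Proof.
move=> r0 r1; pose D t := 1 - 2 * rho * cos t + rho ^+ 2.
have D0 : D tau != 0 by rewrite gt_eqF// poisson_den_gt0.
have dD : is_derive tau 1 D (2 * rho * sin tau).
  have h1 : is_derive tau 1 (fun t => 2 * rho * cos t) (2 * rho * - sin tau).
    by apply: is_deriveZ.
  have h2 : is_derive tau 1 (fun t => 1 - 2 * rho * cos t) (0 - 2 * rho * - sin tau).
    exact: is_deriveB.
  have h3 : is_derive tau 1 D (0 - 2 * rho * - sin tau + 0).
    exact: is_deriveD.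
  by rewrite -[X in is_derive _ _ _ X]addr0 (_ : 2 * rho * sin tau =
    0 - 2 * rho * - sin tau)// sub0r mulrN opprK.
have h4 : is_derive tau 1 (fun t => (D t)^-1) (- (D tau) ^- 2 *: (2 * rho * sin tau)).
  exact: is_deriveV.
have h5 : is_derive tau 1 (fun t => (1 - rho ^+ 2) * (D t)^-1)
    ((1 - rho ^+ 2) *: (- (D tau) ^- 2 *: (2 * rho * sin tau))).
  exact: is_deriveZ.
have -> : dpoisson rho tau = (1 - rho ^+ 2) *: (- (D tau) ^- 2 *: (2 * rho * sin tau)).
  rewrite /dpoisson -[_ *: _]/(_ * (_ * _)) -/(D tau); field; exact: D0.
exact: h5.
Qed.

Lemma dpoisson_cont rho : 0 <= rho -> rho < 1 -> continuous (dpoisson rho).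
Proof.
move=> r0 r1 t; apply: cvgM.
  apply: cvgN; apply: cvgM; first exact: cvg_cst.
  by apply: cvgM; [exact: cvg_cst|exact: continuous_sin].
apply: cvgV; first by rewrite expf_neq0// gt_eqF// poisson_den_gt0.
apply: (@continuous_comp _ _ _ (fun t => 1 - 2 * rho * cos t + rho ^+ 2)
    (fun x => x ^+ 2)); last exact: exprn_continuous.
apply: cvgD; last exact: cvg_cst.
apply: cvgB; first exact: cvg_cst.
by apply: cvgM; [exact: cvg_cst|exact: continuous_cos].
Qed.

Lemma dpoisson_le0 rho tau : 0 <= rho -> rho < 1 -> 0 <= tau -> tau <= pi -> dpoisson rho tau <= 0.
Proof.
move=> r0 r1 t0 tpi; rewrite /dpoisson mulNr oppr_le0 divr_ge0 ?sqr_ge0// mulr_ge0//.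
  by rewrite subr_ge0 expr_le1// ltW.
by rewrite mulr_ge0 ?mulr_ge0// sin_ge0_pi// t0 tpi.
Qed.

(** A decreasing kernel is a positive mixture of centred intervals. In integrated form: with
    [Q >= 0] the primitive of [q], the integral is [P(pi) Q(pi)] minus the integral of [P' Q], where
    [P >= 0] and [P' <= 0] on [[0, pi]]. *)
Lemma poisson_by_parts rho q : 0 <= rho -> rho < 1 -> continuous q ->
  (forall tau, 0 <= tau -> tau <= pi -> 0 <= segint q 0 tau) ->
  0 <= segint (fun tau => poisson rho tau * q tau) 0 pi.
Proof.
move=> r0 r1 cq Q0.
have [F [dF FE]] := @primitive_exists R q (-1) cq.
pose Q t := F t - F 0.
have QE t : 0 <= t -> segint q 0 t = Q t by move=> t0; rewrite FE//; lra.
have dQ t : 0 <= t -> is_derive t 1 Q (q t).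
  move=> t0; have h := dF t ltac:(lra).
  by rewrite -[X in is_derive _ _ _ X]subr0; apply: is_deriveB.
have pi0 : 0 <= pi :> R by exact: pi_ge0.
have cF t : 0 <= t -> {for t, continuous Q}.
  move=> t0; apply: differentiable_continuous; apply/derivable1_diffP.
  by case: (dQ t t0).
have cP t : {for t, continuous (poisson rho)} by exact: poisson_cont.
have cdP t : {for t, continuous (dpoisson rho)} by exact: dpoisson_cont.
have c1 : cont_on (fun t => dpoisson rho t * Q t) 0 pi.
  apply: cont_onM => t; first by move=> _; exact: cdP.
  by rewrite in_itv/= => /andP[t0 _]; exact: cF.
have c2 : cont_on (fun t => poisson rho t * q t) 0 pi.
  by apply: cont_onM => t _; [exact: cP|exact: cq].
have : segint (fun t => dpoisson rho t * Q t + poisson rho t * q t) 0 pi =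
    poisson rho pi * Q pi - poisson rho 0 * Q 0.
  apply: (@segint_FTC _ _ (fun t => poisson rho t * Q t) _ _ pi0).
    by move=> t t0 tp; apply: cvgD; apply: cvgM; [exact: cdP|exact: cF|exact: cP|exact: cq].
  move=> t t0 tp; have h1 := is_derive_poisson t r0 r1; have h2 := dQ t t0.
  rewrite addrC -[dpoisson rho t * Q t]mulrC.
  exact: is_deriveM.
rewrite segintD// [Q 0]/Q subrr mulr0 subr0 => E.
have h1 : segint (fun t => dpoisson rho t * Q t) 0 pi <= 0.
  have z : segint (fun=> 0) 0 pi = 0 :> R by rewrite segint_cst// mul0r.
  rewrite -[leRHS]z.
  apply: segint_le => //; first exact: cont_on_cst.
  move=> t t0 tp; apply: mulr_le0_ge0; first exact: dpoisson_le0.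
  by rewrite -QE// Q0.
have h2 : 0 <= poisson rho pi * Q pi.
  by rewrite mulr_ge0 ?poisson_ge0// -QE// Q0.
by clear -E h1 h2; lra.
Qed.

(** The period is recentred at [t0] and folded, which exposes the even kernel to integration by
    parts on [[0, pi]]. *)
Lemma segint_symm v t0 : 0 <= t0 -> t0 <= 2 * pi -> continuous v ->
  (forall t, v (t + 2 * pi) = v t) ->
  segint v 0 (2 * pi) = segint (fun tau => v (t0 + tau) + v (t0 - tau)) 0 pi.
Proof.
move=> t00 t02 cv pv; have pi0 : 0 <= pi :> R by exact: pi_ge0.
have ca c : continuous (fun t => v (t + c)).
  move=> t; apply: (@continuous_comp _ _ _ (fun t => t + c) v); last exact: cv.
  by apply: cvgD; [exact: cvg_id|exact: cvg_cst].
rewrite -(segint_periodic v (2 * pi) (t0 - pi))//; [|lra|lra].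
have -> : t0 - pi + 2 * pi = pi + t0 by ring.
rewrite addrC -segint_shift//; last by lra.
rewrite (segint_split _ (- pi) pi 0); [|by move=> t _; exact: ca|lra|lra].
have := segint_opp _ 0 pi (ca t0) pi0; rewrite oppr0 => <-.
rewrite -segintD.
- by apply: eq_segint => t _ _; rewrite addrC [t + t0]addrC [- t + t0]addrC.
- move=> t _; apply: (@continuous_comp _ _ _ -%R (fun t => v (t + t0))); first exact: opp_continuous.
  exact: ca.
- by move=> t _; exact: ca.
Qed.

End radially_decreasing_kernel.

Section maximal.
Context {R : realType} {E : hilbert R}.
Notation mu := (@lebesgue_measure R).
Implicit Types (f : R[i] -> E) (r s t m : R).

(** The hypothesis says that [q], which is [2 m] minus the folded [|f|^2], has a nonnegative
    primitive. Then [poisson_by_parts] bounds the Poisson average by [m], and [poisson_ineq] bounds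
    the value by that average, uniformly in [r < s]. *)
Lemma sqn_le_averages f S r s t0 m : hol f S -> 0 <= r -> r < s -> s < S -> 0 <= t0 -> t0 <= 2 * pi ->
  (forall tau, 0 < tau -> tau <= pi -> segint (sqn f s) (t0 - tau) (t0 + tau) <= 2 * tau * m) ->
  sqn f r t0 <= m.
Proof.
move=> fS r0 rs sS t00 t02 Hm; have s0 := le_lt_trans r0 rs.
have rho0 : 0 <= r / s by rewrite divr_ge0// ltW.
have rho1 : r / s < 1 by rewrite ltr_pdivrMr// mul1r.
have pi0 : 0 < pi :> R by exact: pi_gt0.
have cu : continuous (sqn f s) by apply: (sqn_cont fS); rewrite gtr0_norm.
have cP : continuous (fun t => poisson (r / s) (t - t0)) by exact: poisson_shift_cont.
have even t : poisson (r / s) (- t) = poisson (r / s) t by rewrite /poisson cosN.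
have cadd : continuous (fun tau => sqn f s (t0 + tau)).
  move=> t; apply: (@continuous_comp _ _ _ (fun t => t0 + t) (sqn f s)); last exact: cu.
  by apply: cvgD; [exact: cvg_cst|exact: cvg_id].
have csub : continuous (fun tau => sqn f s (t0 - tau)).
  move=> t; apply: (@continuous_comp _ _ _ (fun t => t0 - t) (sqn f s)); last exact: cu.
  by apply: cvgB; [exact: cvg_cst|exact: cvg_id].
pose q tau := 2 * m - (sqn f s (t0 + tau) + sqn f s (t0 - tau)).
have cq : continuous q.
  by move=> t; apply: cvgB; [exact: cvg_cst|apply: cvgD; [exact: cadd|exact: csub]].
have Q0 tau : 0 <= tau -> tau <= pi -> 0 <= segint q 0 tau.
  rewrite le_eqVlt => /predU1P[<-|tau0 taupi]; first by rewrite segint_nil.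
  have E1 : segint (fun x => sqn f s (t0 + x) + sqn f s (t0 - x)) 0 tau =
      segint (sqn f s) (t0 - tau) (t0 + tau).
    rewrite segintD; [|by move=> t _; exact: cadd|by move=> t _; exact: csub].
    have e1 : segint (fun x => sqn f s (t0 + x)) 0 tau = segint (sqn f s) t0 (t0 + tau).
      have h := segint_shift (sqn f s) 0 tau t0 cu (ltW tau0).
      rewrite add0r in h; rewrite [t0 + tau]addrC -h.
      by apply: eq_segint => x _ _; rewrite addrC.
    have e2 : segint (fun x => sqn f s (t0 - x)) 0 tau = segint (sqn f s) (t0 - tau) t0.
      have h := segint_opp (fun x => sqn f s (t0 + x)) 0 tau cadd (ltW tau0).
      rewrite h oppr0 [t0 - tau]addrC.
      have h' := segint_shift (sqn f s) (- tau) 0 t0 cu; rewrite add0r in h'.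
      rewrite -h' ?oppr_le0 ?ltW//.
      by apply: eq_segint => x _ _; rewrite addrC.
    rewrite e1 e2 addrC -segint_split//.
    - by rewrite lerBlDr lerDl ltW.
    - by rewrite lerDl ltW.
  rewrite /q segintB.
  - rewrite segint_cst ?(ltW tau0)// E1 subr0 subr_ge0.
    by have := Hm tau tau0 taupi; rewrite mulrAC.
  - exact: cont_on_cst.
  - by apply: cont_onD => t _; [exact: cadd|exact: csub].
have H := poisson_by_parts rho0 rho1 cq Q0.
have cPa : continuous (poisson (r / s)) by exact: poisson_cont.
have pP t : poisson (r / s) (t + 2 * pi - t0) = poisson (r / s) (t - t0).
  by rewrite /poisson [t + _ - _]addrAC [2 * pi]mulr_natl cosD2pi.
have I1 := poisson_ineq t0 fS r0 rs sS.
have I2 := int_poisson t0 r0 rs.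
rewrite (segint_symm t00 t02) in I2; last 2 first.
- exact: cP.
- exact: pP.
rewrite (segint_symm t00 t02) in I1; last 2 first.
- by move=> t; apply: cvgM; [exact: cu|exact: cP].
- by move=> t; rewrite sqn_periodic pP.
have E1 : segint (fun tau => poisson (r / s) tau * q tau) 0 pi =
  m * segint (fun tau => poisson (r / s) (t0 + tau - t0) + poisson (r / s) (t0 - tau - t0)) 0 pi -
  segint (fun tau => sqn f s (t0 + tau) * poisson (r / s) (t0 + tau - t0) +
    sqn f s (t0 - tau) * poisson (r / s) (t0 - tau - t0)) 0 pi.
  have cs1 : continuous (fun tau => poisson (r / s) (t0 + tau - t0)).
    move=> t; have -> : (fun tau => poisson (r / s) (t0 + tau - t0)) = poisson (r / s).
      by apply/funext => x; rewrite addrAC subrr add0r.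
    exact: cPa.
  have cs2 : continuous (fun tau => poisson (r / s) (t0 - tau - t0)).
    move=> t; have -> : (fun tau => poisson (r / s) (t0 - tau - t0)) = poisson (r / s).
      by apply/funext => x; rewrite addrAC subrr add0r even.
    exact: cPa.
  rewrite -(segintZ m); last by apply: cont_onD => t _; [exact: cs1|exact: cs2].
  rewrite -segintB.
  - apply: eq_segint => t _ _; rewrite /q.
    have -> : t0 + t - t0 = t by rewrite addrAC subrr add0r.
    have -> : t0 - t - t0 = - t by rewrite addrAC subrr add0r.
    by rewrite even; clear; ring.
  - apply: cont_onM; first exact: cont_on_cst.
    by apply: cont_onD => t _; [exact: cs1|exact: cs2].
  - by apply: cont_onD; apply: cont_onM => t _; [exact: cadd|exact: cs1|exact: csub|exact: cs2].
rewrite E1 I2 in H.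
have p20 : 0 < 2 * pi :> R by rewrite mulr_gt0.
rewrite -(ler_pM2l p20); apply: le_trans I1 _.
by rewrite -subr_ge0 [2 * pi * m]mulrC.
Qed.

End maximal.

Section segint_ereal.
Context {R : realType}.
Notation mu := (@lebesgue_measure R).

Lemma integral_segint (f : R -> R) a b : cont_on f a b ->
  (\int[mu]_(x in `[a, b]) (f x)%:E)%E = (segint f a b)%:E.
Proof.
by move=> cf; rewrite /segint /Rintegral fineK//; apply: integrable_fin_num => //; exact: cont_on_integrable.
Qed.

Lemma continuous_EFin_measurable (f : R -> R) (D : set (measurableTypeR R)) : measurable D ->
  continuous f -> measurable_fun D (fun x => (f x)%:E).
Proof.
by move=> mD cf; apply/measurable_EFinP; apply: measurable_funTS; exact: continuous_measurable_fun.
Qed.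

End segint_ereal.

Section weak_type.
Context {R : realType} {E : hilbert R}.
Notation mu := (@lebesgue_measure R).
Implicit Types (f : R[i] -> E) (r s t m : R).

(** A level set of the radial maximal function of [|f|^2]. The witness [r] presents it, within the
    angle interval, as a union of open sets, hence as measurable although the union is
    uncountable. *)
Definition radial_sup_gt f s c : set R :=
  [set t | [/\ 0 <= t, t <= 2 * pi & exists r, [/\ 0 <= r, r < s & c < sqn f r t]]].

Lemma radial_sup_gt_measurable f S s c : hol f S -> s <= S -> measurable (radial_sup_gt f s c).
Proof.
move=> fS sS.
have -> : radial_sup_gt f s c = `[0, 2 * pi] `&` \bigcup_(r in [set r | 0 <= r < s]) [set t | c < sqn f r t].
  apply/seteqP; split=> t /=; rewrite in_itv/=.
    by move=> [-> -> [r [r0 rs cr]]]; split=> //; exists r => //=; rewrite r0.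
  by move=> [/andP[t0 t2] [r /= /andP[r0 rs] cr]]; split=> //; exists r.
apply: measurableI => //; apply: open_measurable; apply: bigcup_open => r /= /andP[r0 rs].
have cu : continuous (sqn f r).
  by apply: (sqn_cont fS); rewrite ger0_norm// (lt_le_trans rs).
by apply: (@open_comp _ _ (sqn f r) [set x | c < x]); [move=> t _; exact: cu|exact: open_gt].
Qed.

(** By [sqn_le_averages] the level set lies in that of the Hardy-Littlewood maximal function of the
    circle data. The constant 9 is the 3 of the maximal inequality times the 3 periods on which the
    data are kept. *)
Lemma weak_type f S s K c : hol f S -> 0 < s -> s < S -> 0 < c ->
  segint (sqn f s) 0 (2 * pi) <= K ->
  (mu (radial_sup_gt f s c) <= (9 * K / c)%:E)%E.
Proof.
move=> fS s0 sS c0 MK.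
have pi0 : 0 < pi :> R by exact: pi_gt0.
have cu : continuous (sqn f s) by apply: (sqn_cont fS); rewrite gtr0_norm.
have co a b : cont_on (sqn f s) a b by move=> t _; exact: cu.
(* Every arc of half-length at most [pi] centred in [[0, 2 pi]] fits inside; whole periods make the
   integral of [g] computable. *)
pose a : R := - (2 * pi); pose b : R := 2 * pi + 2 * pi.
pose g := sqn f s \_ `[a, b].
have lg : locally_integrable setT g.
  by apply: integrable_locally => //; exact: cont_on_integrable.
have sub : radial_sup_gt f s c `<=` [set t | HL_maximal g t > c%:E]%E.
  move=> t [t0 t2 [r [r0 rs]]] /=; apply: contraTT; rewrite -leNgt -leNgt => Hc.
  apply: (sqn_le_averages fS r0 rs sS t0 t2) => tau tau0 taupi.
  have : (iavg g (ball t tau) <= c%:E)%E.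
    apply: le_trans Hc; apply: ereal_sup_ubound; exists tau => //=.
    by rewrite in_itv/= tau0.
  rewrite /iavg lebesgue_measure_ball ?(ltW tau0)//.
  have -> : (\int[mu]_(y in ball t tau) `|(g y)%:E| = (segint (sqn f s) (t - tau) (t + tau))%:E)%E.
    rewrite -integral_segint// ball_itv.
    rewrite [RHS]integral_itv_bndoo; last exact: continuous_EFin_measurable.
    apply: eq_integral => y; rewrite inE/= in_itv/= => /andP[y1 y2].
    have yab : `[a, b]%classic y.
      by rewrite /= in_itv/= /a /b; apply/andP; split; clear -t0 t2 y1 y2 taupi; lra.
    by rewrite /g patchE mem_set//= ger0_norm ?sqn_ge0.
  rewrite inver mulrn_eq0/= gt_eqF// -EFinM lee_fin => h.
  have p0 : 0 < tau *+ 2 by rewrite mulrn_wgt0.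
  by rewrite mulr_natl -ler_pdivrMl.
apply: (@le_trans _ _ (mu [set t | HL_maximal g t > c%:E]%E)).
  apply: le_measure; [rewrite inE|rewrite inE|exact: sub].
    by apply: radial_sup_gt_measurable fS _; exact: ltW.
  rewrite -[X in measurable X]setTI; apply: emeasurable_fun_o_infty => //.
  exact: measurable_HL_maximal.
apply: le_trans (maximal_inequality lg c0) _.
have -> : (\int[mu]_(y in setT) `|(g y)%:E| = (segint (sqn f s) a b)%:E)%E.
  rewrite -integral_segint// [RHS]integral_mkcond; apply: eq_integral => y _.
  rewrite /g /= !patchE; case: ifPn => _; last by rewrite normr0.
  by rewrite ger0_norm ?sqn_ge0.
have -> : segint (sqn f s) a b = 3 * segint (sqn f s) 0 (2 * pi).
  have per u := @sqn_periodic R E f s u.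
  have e1 := segint_periodic (sqn f s) (2 * pi) a _ _ cu per.
  have e3 := segint_periodic (sqn f s) (2 * pi) (2 * pi) _ _ cu per.
  rewrite (segint_split _ a b 0)//; [|by rewrite /a; lra|by rewrite /b; lra].
  rewrite (segint_split _ 0 b (2 * pi))//; [|lra|by rewrite /b; lra].
  rewrite e3; [|lra|lra].
  have -> : segint (sqn f s) a 0 = segint (sqn f s) 0 (2 * pi).
    by rewrite -e1 /a ?addNr//; lra.
  by ring.
rewrite -EFinM lee_fin.
have -> : 3 / c * (3 * segint (sqn f s) 0 (2 * pi)) = 9 * segint (sqn f s) 0 (2 * pi) / c.
  by field; rewrite gt_eqF.
by rewrite ler_pM2r ?invr_gt0// ler_pM2l.
Qed.

Lemma weak_type_disc f K c : hol f 1 -> 0 < c ->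
  (forall s, 0 < s -> s < 1 -> segint (sqn f s) 0 (2 * pi) <= K) ->
  (mu (radial_sup_gt f 1 c) <= (9 * K / c)%:E)%E.
Proof.
move=> f1 c0 MK.
(* [weak_type] needs radii strictly inside the disc and positive, so the index starts at 2;
   continuity of the measure along the increasing level sets passes to radius 1. *)
pose s_ (n : nat) : R := 1 - n.+2%:R^-1.
have s0 n : 0 < s_ n by rewrite subr_gt0 invf_lt1// ltr1n.
have s1 n : s_ n < 1 by rewrite ltrBlDr ltrDl invr_gt0.
have E1 : radial_sup_gt f 1 c = \bigcup_n radial_sup_gt f (s_ n) c.
  apply/seteqP; split=> t.
    move=> [t0 t2 [r [r0 r1 cr]]].
    have [n Hn] : exists n, r < s_ n.
      exists (Num.truncn (1 - r)^-1); rewrite /s_ ltrBrDl -ltrBrDr.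
      rewrite invf_plt ?posrE ?subr_gt0//; apply: lt_le_trans (truncnS_gt _) _.
      by rewrite ler_nat.
    by exists n => //; split=> //; exists r.
  move=> [n _ [t0 t2 [r [r0 r1 cr]]]]; split=> //; exists r; split=> //.
  exact: lt_trans (s1 n).
have mF n : measurable (radial_sup_gt f (s_ n) c).
  by apply: radial_sup_gt_measurable f1 _; exact: ltW.
have nd : nondecreasing_seq (fun n => radial_sup_gt f (s_ n) c).
  move=> m n mn; apply/subsetPset => t [t0 t2 [r [r0 rs cr]]]; split=> //; exists r; split=> //.
  apply: lt_le_trans rs _; rewrite /s_ lerD2l lerN2 lef_pV2 ?posrE//.
  by rewrite ler_nat.
have mU : measurable (\bigcup_n radial_sup_gt f (s_ n) c) by exact: bigcupT_measurable.
have cv := nondecreasing_cvg_mu mF mU nd (mu := mu).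
rewrite E1 -(cvg_lim _ cv)//; apply: lime_le; first by apply/cvg_ex; eexists; exact: cv.
by apply: nearW => n; apply: weak_type f1 _ _ _ _ => //; exact: MK.
Qed.

End weak_type.

Section convolution_swap.
Context {R : realType}.
Notation mu := (@lebesgue_measure R).

Lemma integral_indicM (a b : R) (g : R -> R) :
  (\int[mu]_y (\1_(`[a, b]) y * g y)%:E = \int[mu]_(y in `[a, b]) (g y)%:E)%E.
Proof.
rewrite [RHS]integral_mkcond; apply: eq_integral => y _.
by rewrite patchE indicE; case: ifPn => _; rewrite ?mul1r ?mul0r.
Qed.

(** The pointwise bound is integrated and the order exchanged by Tonelli's theorem. The right side
    stays an extended integral, as the continuity of its inner integral in [y] is not
    established. *)
Lemma segint_conv_le (u P v : R -> R) (a b : R) : continuous u -> continuous P -> continuous v ->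
  (forall t, 0 <= u t) -> (forall t, 0 <= P t) -> (forall t, 0 <= v t) ->
  (forall x, a <= x -> x <= b -> v x <= segint (fun y => u y * P (y - x)) a b) ->
  ((segint v a b)%:E <= \int[mu]_(y in `[a, b]) (u y * segint (fun x => P (y - x)) a b)%:E)%E.
Proof.
move=> cu cP cv u0 P0 v0 H.
pose I : set R := `[a, b]%classic.
pose F (z : R * R) : \bar R := (\1_I z.1 * (\1_I z.2 * (u z.2 * P (z.2 - z.1))))%:E.
have F0 z : (0 <= F z)%E by rewrite lee_fin !indicE;
    apply: mulr_ge0; [exact: ler0n|apply: mulr_ge0; [exact: ler0n|exact: mulr_ge0]].
have mu_ (g : R -> R) : continuous g -> measurable_fun setT g by exact: continuous_measurable_fun.
have mI : measurable_fun setT (\1_I : R -> R) by apply: measurable_indic; exact: measurable_itv.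
have mF : measurable_fun setT F.
  apply/measurable_EFinP; apply: measurable_funM.
    exact: (measurableT_comp mI measurable_fst).
  apply: measurable_funM; first exact: (measurableT_comp mI measurable_snd).
  apply: measurable_funM; first exact: (measurableT_comp (mu_ _ cu) measurable_snd).
  apply: (measurableT_comp (mu_ _ cP)).
  by apply: measurable_funB; [exact: measurable_snd|exact: measurable_fst].
have cPx x : continuous (fun y => P (y - x)).
  move=> y; apply: (@continuous_comp _ _ _ (fun y => y - x) P); last exact: cP.
  by apply: cvgB; [exact: cvg_id|exact: cvg_cst].
have cPy y : continuous (fun x => P (y - x)).
  move=> x; apply: (@continuous_comp _ _ _ (fun x => y - x) P); last exact: cP.
  by apply: cvgB; [exact: cvg_cst|exact: cvg_id].
have co (g : R -> R) : continuous g -> cont_on g a b by move=> cg x _; exact: cg.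
have cux x : cont_on (fun y => u y * P (y - x)) a b.
  by apply: cont_onM; [exact: co|exact/co/cPx].
have Fx x : (\int[mu]_y F (x, y) = (\1_I x * segint (fun y => u y * P (y - x)) a b)%:E)%E.
  rewrite /F /= indicE; case: (x \in I).
    under eq_integral do rewrite mul1r.
    by rewrite mul1r integral_indicM integral_segint.
  under eq_integral do rewrite mul0r.
  by rewrite integral0 mul0r.
have Fy y : (\int[mu]_x F (x, y) = (\1_I y * (u y * segint (fun x => P (y - x)) a b))%:E)%E.
  rewrite /F /=; under eq_integral do rewrite mulrCA.
  rewrite indicE; case: (y \in I).
    under eq_integral do rewrite mul1r.
    have cc := co _ (cPy y).
    rewrite mul1r integral_indicM integral_segint ?segintZ//.
    by apply: cont_onM => //; exact: cont_on_cst.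
  under eq_integral do rewrite mul0r.
  by rewrite integral0 mul0r.
rewrite -integral_indicM.
under eq_integral do rewrite -Fy.
rewrite -(@fubini_tonelli _ _ _ _ _ mu mu F mF F0).
rewrite -integral_segint; last exact: co.
rewrite -integral_indicM; apply: ge0_le_integral => //.
- by move=> x _; rewrite lee_fin indicE; apply: mulr_ge0; first exact: ler0n.
- by apply/measurable_EFinP; apply: measurable_funM => //; exact: mu_.
- exact: measurable_fun_fubini_tonelli_F.
- move=> x _; rewrite Fx lee_fin indicE; case: (boolP (x \in I)) => [xI|_]; last by rewrite !mul0r.
  by rewrite !mul1r; move/set_mem: xI; rewrite /I /= in_itv/= => /andP[? ?]; exact: H.
Qed.

End convolution_swap.

(** * Monotone means and the tail estimate *)

Section means.
Context {R : realType} {E : hilbert R}.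
Notation mu := (@lebesgue_measure R).
Implicit Types (f : R[i] -> E) (r s t m : R).

Definition mean2 f r := segint (sqn f r) 0 (2 * pi).

(** [poisson_ineq] is integrated over the angle of the smaller circle. After the exchange the kernel
    is integrated in its other variable, and evenness reduces this to [int_poisson]. *)
Lemma mean2_mono f S r s : hol f S -> 0 <= r -> r <= s -> s < S -> mean2 f r <= mean2 f s.
Proof.
move=> fS r0; rewrite le_eqVlt => /predU1P[->//|rs sS]; have s0 := le_lt_trans r0 rs.
have pi2 : 0 < 2 * pi :> R by rewrite mulr_gt0// pi_gt0.
have cr : continuous (sqn f r) by apply: (sqn_cont fS); rewrite ger0_norm// (lt_trans rs).
have cs : continuous (sqn f s) by apply: (sqn_cont fS); rewrite gtr0_norm.
have rho0 : 0 <= r / s by rewrite divr_ge0// ltW.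
have rho1 : r / s < 1 by rewrite ltr_pdivrMr// mul1r.
have co (g : R -> R) : continuous g -> cont_on g 0 (2 * pi) by move=> cg x _; exact: cg.
have := @segint_conv_le R (sqn f s) (poisson (r / s)) (fun t => 2 * pi * sqn f r t) 0 (2 * pi) cs
  (poisson_cont rho0 rho1).
have c2 : continuous (fun t => 2 * pi * sqn f r t).
  by move=> t; apply: cvgM; [exact: cvg_cst|exact: cr].
move=> /(_ c2 (sqn_ge0 f s) (fun t => poisson_ge0 t rho0 rho1)).
move=> /(_ (fun t => mulr_ge0 (ltW pi2) (sqn_ge0 f r t))).
move=> /(_ (fun x _ _ => poisson_ineq x fS r0 rs sS)).
rewrite (_ : (\int[mu]_(y in _) _)%E = (2 * pi * mean2 f s)%:E).
  rewrite lee_fin segintZ; last exact: co.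
  by rewrite ler_pM2l.
rewrite /mean2 -segintZ; last exact: co.
rewrite -integral_segint; last by apply: cont_onM; [exact: cont_on_cst|exact: co].
apply: eq_integral => y _; congr (_%:E); rewrite mulrC; congr (_ * _).
rewrite -[RHS](int_poisson y r0 rs); apply: eq_segint => x _ _.
by rewrite /poisson -(opprB x y) cosN.
Qed.

End means.

Section tails.
Context {R : realType} {E : hilbert R}.
Implicit Types (f g : R[i] -> E) (r s t m rho : R).

Definition dilate f rho : R[i] -> E := fun w => f (rho%:C * w).

Lemma holP f S : hol f S <-> forall w, cabs w < S -> derivable (f : R[i]^o -> E) w 1.
Proof.
split=> fS w /fS; first by move=> [d]; exact: cdiff_derivable.
by move=> /derivable_cdiff ?; exists ('D_1 (f : R[i]^o -> E) w).
Qed.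

Lemma holD f g S : hol f S -> hol g S -> hol (fun w => f w + g w) S.
Proof.
by move=> /holP fS /holP gS; apply/holP => w wS; exact (derivableD (fS w wS) (gS w wS)).
Qed.

Lemma holB f g S : hol f S -> hol g S -> hol (fun w => f w - g w) S.
Proof.
by move=> /holP fS /holP gS; apply/holP => w wS; exact (derivableB (fS w wS) (gS w wS)).
Qed.

Lemma hol_dilate f rho : hol f 1 -> 0 < rho -> rho <= 1 -> hol (dilate f rho) 1.
Proof.
move=> f1 rho0 rho1 w w1.
have [d Hd] : exists d, cdiff f (rho%:C * w) d.
  apply: f1; rewrite cabsM cabsR gtr0_norm//; apply: le_lt_trans w1.
  by rewrite ler_piMl// cabs_ge0.
exists (rho%:C *: d) => e e0; have [dl dl0 H] := Hd (e / rho) (divr_gt0 e0 rho0).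
exists (dl / rho); first by rewrite divr_gt0.
move=> u; rewrite ltr_pdivlMr// => uw.
have E1 : cabs (rho%:C * u - rho%:C * w) = cabs (u - w) * rho.
  by rewrite -mulrBr cabsM cabsR gtr0_norm// mulrC.
have := H (rho%:C * u); rewrite E1 => /(_ uw).
rewrite /dilate (_ : (u - w) *: (rho%:C *: d) = (rho%:C * u - rho%:C * w) *: d).
  by move=> h; apply: le_trans h _; rewrite mulrCA divfK ?gt_eqF// mulrC.
by rewrite scalerA -mulrBr mulrC.
Qed.

Lemma sqn_dilate f rho r t : sqn (dilate f rho) r t = sqn f (rho * r) t.
Proof. by rewrite /sqn /dilate mulrA -rmorphM. Qed.

Lemma mean2_dilate f rho r : mean2 (dilate f rho) r = mean2 f (rho * r).
Proof. by apply: eq_segint => t _ _; exact: sqn_dilate. Qed.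

Lemma mean2_ge0 f r : 0 <= mean2 f r.
Proof. by apply: segint_ge0 => t _ _; exact: sqn_ge0. Qed.

Lemma mean2_parallelogram f g S r : hol f S -> hol g S -> `|r| < S ->
  mean2 (fun w => f w + g w) r + mean2 (fun w => f w - g w) r = 2 * mean2 f r + 2 * mean2 g r.
Proof.
move=> fS gS rS.
have co (h : R[i] -> E) (hS : hol h S) : cont_on (sqn h r) 0 (2 * pi).
  by move=> t _; exact: (sqn_cont hS).
have c1 := co _ (holD fS gS); have c2 := co _ (holB fS gS).
have c3 := co _ fS; have c4 := co _ gS.
have c5 := cont_onM _ _ _ _ (@cont_on_cst R 2 0 (2 * pi)) c3.
have c6 := cont_onM _ _ _ _ (@cont_on_cst R 2 0 (2 * pi)) c4.
rewrite /mean2 -!segintZ// -!segintD//; apply: eq_segint => t _ _.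
by rewrite /sqn parallelogram.
Qed.

Lemma mean2_le_sup f S r e : hol f S -> `|r| < S -> 0 <= e ->
  (forall t, 0 <= t -> t <= 2 * pi -> sqn f r t <= e) -> mean2 f r <= 2 * pi * e.
Proof.
move=> fS rS e0 H; have pi2 : 0 <= 2 * pi :> R by rewrite mulr_ge0// pi_ge0.
have -> : 2 * pi * e = segint (fun=> e) 0 (2 * pi) by rewrite segint_cst// subr0 mulrC.
by apply: segint_le => //; [move=> t _; exact: (sqn_cont fS)|exact: cont_on_cst].
Qed.

(* Uniform convexity: the sums f + f(rho .) have means close to 4 sup M while,
   by monotonicity, no mean exceeds the supremum; so the differences are small. *)
Lemma mean2_tail f K : hol f 1 -> (forall r, 0 <= r -> r < 1 -> mean2 f r <= K) ->
  forall e, 0 < e -> exists rho0, [/\ 0 < rho0, rho0 < 1 &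
    forall rho, rho0 <= rho -> rho < 1 -> forall r, 0 <= r -> r < 1 ->
      mean2 (fun w => f w - dilate f rho w) r <= e].
Proof.
move=> f1 fK e e0.
pose A := [set mean2 f r | r in [set r | 0 <= r < 1]].
have As : has_sup A.
  split; first by exists (mean2 f 0), 0; rewrite //= lexx ltr01.
  by exists K => _ [r /= /andP[r0 r1] <-]; exact: fK.
have Ab r : 0 <= r -> r < 1 -> mean2 f r <= sup A.
  by move=> r0 r1; apply: sup_upper_bound => //; exists r; rewrite //= r0.
have e8 : 0 < e / 8 by rewrite divr_gt0.
have [_ [s' /= /andP[s'0 s'1] <-] Hs'] := sup_adherent e8 As.
pose s := (1 + s') / 2.
have s's : s' < s by rewrite /s; clear -s'1; lra.
have s1 : s < 1 by rewrite /s; clear -s'1; lra.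
have s0 : 0 < s := le_lt_trans s'0 s's.
have e4 : 0 < e / (16 * pi) by rewrite divr_gt0// mulr_gt0// pi_gt0.
pose q := Num.sqrt (e / (16 * pi)).
have q0 : 0 < q by rewrite sqrtr_gt0.
have [dl dl0 Hd] := @circle_unif_cont R E f 1 s (fun w => @hol_ccont R E f 1 w f1)
  ltac:(by rewrite gtr0_norm) q q0.
(* The three bounds give, in order: [rho s >= s'], so that the mean at [rho s] is still near the
   supremum; [rho > 0]; and [f(rho s .)] uniformly close to [f(s .)]. *)
pose rho0 := Num.max (Num.max (s' / s) (1 / 2)) (1 - dl / 2).
have r0a : s' / s <= rho0 by rewrite /rho0 !le_max lexx.
have r0b : 1 / 2 <= rho0 by rewrite /rho0 !le_max lexx orbT.
have r0c : 1 - dl / 2 <= rho0 by rewrite /rho0 !le_max lexx orbT.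
exists rho0; split.
- by clear -r0b; lra.
- have h1 : s' / s < 1 by rewrite ltr_pdivrMr// mul1r.
  by rewrite /rho0 !gt_max h1/=; apply/andP; split; clear -dl0; lra.
move=> rho rr rho1.
have rho_gt0 : 0 < rho by clear -rr r0b; lra.
have frho : hol (dilate f rho) 1 by apply: hol_dilate => //; exact: ltW.
have fB := holB f1 frho; have fD := holD f1 frho.
have small : mean2 (fun w => f w - dilate f rho w) s <= e / 8.
  have -> : e / 8 = 2 * pi * (e / (16 * pi)).
    have : (pi : R) != 0 by rewrite gt_eqF// pi_gt0.
    by move: (pi : R) => p p0; field.
  apply: (mean2_le_sup fB); [by rewrite gtr0_norm|exact: ltW|] => t t0 t2.
  rewrite /sqn /dilate mulrA -rmorphM rnormB.
  rewrite -(@sqr_sqrtr _ (e / (16 * pi))) ?(ltW e4)// -/q.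
  rewrite ler_pXn2r ?nnegrE ?rnorm_ge0 ?(ltW q0)//; apply/ltW/Hd => //.
  have h : 0 < (1 - rho) * s by rewrite mulr_gt0// subr_gt0.
  have h2 : (1 - rho) * s <= 1 - rho by rewrite ler_piMr ?subr_ge0 ?(ltW rho1) ?(ltW s1).
  have -> : rho * s - s = - ((1 - rho) * s) by ring.
  by rewrite normrN gtr0_norm//; clear -h2 r0c rr dl0; lra.
have low : sup A - e / 8 <= mean2 f (rho * s).
  apply: le_trans (ltW Hs') _; apply: (mean2_mono f1) => //.
    by rewrite -ler_pdivrMr// (le_trans r0a).
  by rewrite -(mulr1 1); apply: ltr_pM => //; exact: ltW.
have low' : sup A - e / 8 <= mean2 f s.
  by apply: le_trans (ltW Hs') _; apply: (mean2_mono f1) => //; exact: ltW.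
(* At radius [s] the sum has mean at least [4 sup A - 4 e / 8 - e / 8], and this persists at [r] by
   monotonicity. The parallelogram law at [r] leaves at most [5 e / 8] for the difference. *)
have big r : s <= r -> r < 1 -> mean2 (fun w => f w - dilate f rho w) r <= e.
  move=> sr r1; have r0 := lt_le_trans s0 sr.
  have P1 := mean2_parallelogram f1 frho (ltac:(by rewrite gtr0_norm) : `|s| < 1).
  have P2 := mean2_parallelogram f1 frho (ltac:(by rewrite gtr0_norm) : `|r| < 1).
  have mD := mean2_mono fD (ltW s0) sr r1.
  rewrite !mean2_dilate in P1 P2.
  have u1 := Ab r (ltW r0) r1.
  have u2 : mean2 f (rho * r) <= sup A.
    by apply: Ab; [rewrite mulr_ge0// ltW|rewrite -(mulr1 1); apply: ltr_pM => //; exact: ltW].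
  clear -P1 P2 mD u1 u2 small low low' e0; lra.
move=> r r0 r1; have [/big//|rs] := leP s r; first exact.
apply: le_trans (big s (lexx _) s1); apply: (mean2_mono fB) => //; exact: ltW.
Qed.

End tails.

(** * Existence of radial limits almost everywhere *)

Section radial_limits.
Context {R : realType} {E : hilbert R}.
Notation mu := (@lebesgue_measure R).
Implicit Types (f g : R[i] -> E) (r s t m rho : R).

Lemma cvg_radial_eps (V : normedModType R[i]) (u : R -> V) (l : V) : u r @[r --> (1 : R)^'-] --> l ->
  forall e, 0 < e -> exists2 dl : R, 0 < dl & forall r, 1 - dl < r -> r < 1 -> rnorm (u r - l) < e.
Proof.
move=> ul e e0; have eC : 0 < e%:C by rewrite ltcR.
have /cvgrPdist_lt/(_ _ eC) := ul.
move=> /nbhs_ballP[dl /= dl0 H]; exists dl => // r r1 r2.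
have := H r; rewrite /ball/= gtr0_norm ?subr_gt0// => /(_ _ r2).
rewrite normVE ltcR rnormB; apply.
by rewrite ltrBlDr addrC -ltrBlDr.
Qed.

(** For fixed [rho < 1] the point [rho r cis t] tends to an interior point, so [f(rho cis t)] is a
    centre within [e] of all values [f(r cis t)] with [r] near 1. *)
Lemma radial_cvg_of_cauchy f t : hol f 1 ->
  (forall e, 0 < e -> exists rho, [/\ 0 < rho, rho < 1 & forall r, 0 <= r -> r < 1 ->
     rnorm (f (r%:C * cis t) - f ((rho * r)%:C * cis t)) <= e]) ->
  cvg (f (r%:C * cis t) @[r --> (1 : R)^'-]).
Proof.
move=> f1 H; apply: cauchy_cvg; apply: cauchy_exP => -[e y].
rewrite ltcE/= => /andP[/eqP -> e0].
have e4 : 0 < e / 2 by rewrite divr_gt0.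
have [rho [rho0 rho1 Hr]] := H _ e4.
have [dl dl0 Hd] := hol_ccont f1 (ltac:(by rewrite cabs_polar gtr0_norm) : cabs (rho%:C * cis t) < 1) e4.
exists (f (rho%:C * cis t)).
near=> r.
have r0 : 0 <= r by apply/ltW; near: r; apply: nbhs_left_gt.
have r1 : r < 1 by near: r; exact: nbhs_left_lt.
have r2 : 1 - dl < r by near: r; apply: nbhs_left_gt; rewrite ltrBlDr ltrDl.
rewrite /= -ball_normE /ball_ /= normVE ltcR rnormB.
rewrite -(subrK (f ((rho * r)%:C * cis t)) (f (r%:C * cis t))) -addrA.
apply: le_lt_trans (rnormD _ _) _; rewrite (splitr e); apply: ler_ltD; first exact: Hr.
apply: Hd; rewrite rmorphM -mulrA -mulrBr cabsM cabsR gtr0_norm//.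
rewrite -[X in _ - X]mul1r -mulrBl cabsM cabs_cis mulr1 -(rmorphB (real_complex R)) cabsR.
apply: (@le_lt_trans _ _ `|r - 1|); first by rewrite ler_piMl// ltW.
by rewrite distrC gtr0_norm ?subr_gt0// ltrBlDr addrC -ltrBlDr.
Unshelve. all: by end_near. Qed.

Definition bounded_means f := exists K, forall r, 0 <= r -> r < 1 -> mean2 f r <= K.

Lemma fatou_radial f : hol f 1 -> bounded_means f ->
  {ae mu, forall t, t \in `[0, 2 * pi] -> cvg (f (r%:C * cis t) @[r --> (1 : R)^'-])}.
Proof.
move=> f1 [K fK].
have tail n : exists rho, [/\ 0 < rho, rho < 1 & forall r, 0 <= r -> r < 1 ->
    mean2 (fun w => f w - dilate f rho w) r <= n.+1%:R^-1].
  have n0 : 0 < n.+1%:R^-1 :> R by rewrite invr_gt0.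
  have [rho0 [h1 h2 h3]] := mean2_tail f1 fK n0.
  by exists rho0; split=> //; apply: h3.
have [rho Hrho] := choice tail.
have hd n : hol (fun w => f w - dilate f (rho n) w) 1.
  by have [h1 h2 _] := Hrho n; apply: holB => //; apply: hol_dilate => //; exact: ltW.
(* The weak bound gives [B j n] measure at most [9 (j + 1) / (n + 1)], so the intersection over [n]
   is null; off these null sets the Cauchy hypothesis holds at every level. *)
pose B j n := radial_sup_gt (fun w => f w - dilate f (rho n) w) 1 (j.+1%:R^-1).
have mB j n : measurable (B j n) by apply: radial_sup_gt_measurable (hd n) (lexx _).
have mBI j : measurable (\bigcap_n B j n) by exact: bigcapT_measurable.
have B0 j : mu (\bigcap_n B j n) = 0%E.
  apply/eqP; rewrite eq_le measure_ge0 andbT; apply/lee_addgt0Pr => e e0; rewrite add0e.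
  pose n := Num.truncn (9 * j.+1%:R / e).
  apply: (@le_trans _ _ (mu (B j n)));
    first by apply: le_measure; [rewrite inE; exact: mBI|rewrite inE; exact: mB|move=> a /(_ n); apply].
  have j0 : 0 < j.+1%:R^-1 :> R by rewrite invr_gt0.
  have [_ _ h3] := Hrho n.
  have h3' s : 0 < s -> s < 1 -> segint (sqn (fun w => f w - dilate f (rho n) w) s) 0 (2 * pi) <= n.+1%:R^-1.
    by move=> s0 s1; exact: h3 (ltW s0) s1.
  have W := weak_type_disc (hd n) j0 h3'.
  apply: le_trans W _.
  rewrite lee_fin invrK mulrAC ler_pdivrMr// [e * _]mulrC -ler_pdivrMr//.
  by apply/ltW; exact: truncnS_gt.
apply: (@negligibleS _ _ _ mu (\bigcup_j \bigcap_n B j n)); last first.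
  by apply: negligible_bigcup => j; apply/negligibleP; [exact: mBI|exact: B0].
move=> t; apply: contra_notP => nB /=; rewrite in_itv/= => /andP[t0 t2].
apply: radial_cvg_of_cauchy => // e e0.
(* Levels concern squared norms, hence [e^2] rather than [e]. *)
pose j := Num.truncn (e ^- 2).
have je : j.+1%:R^-1 <= e ^+ 2.
  rewrite invf_ple ?posrE ?exprn_gt0//; apply/ltW; exact: truncnS_gt.
have [n nBn] : exists n, ~ B j n t.
  by apply/not_existsP => H; apply: nB; exists j => // n _; apply: contrapT; exact: H.
have [h1 h2 _] := Hrho n; exists (rho n); split=> // r r0 r1.
rewrite -(@ler_pXn2r _ 2) ?nnegrE ?rnorm_ge0 ?(ltW e0)//; apply: le_trans je.
rewrite leNgt; apply/negP => lt; apply: nBn; split=> //; exists r; split=> //.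
by rewrite /sqn /dilate mulrA -rmorphM.
Qed.

Lemma lim_radial_eps f t : cvg (f (r%:C * cis t) @[r --> (1 : R)^'-]) ->
  forall e, 0 < e -> exists2 dl : R, 0 < dl & forall r, 1 - dl < r -> r < 1 ->
    rnorm (f (r%:C * cis t) - bdry f (cis t)) < e.
Proof. exact: cvg_radial_eps. Qed.

(** A countable family of radii replaces [r -> 1], as measurability of limits and Fatou's lemma
    require a sequence. *)
Definition rseq (n : nat) : R := 1 - n.+2%:R^-1.

Lemma rseq_ge0 n : 0 <= rseq n.
Proof. by rewrite subr_ge0 invf_le1// ler1n. Qed.

Lemma rseq_lt1 n : rseq n < 1.
Proof. by rewrite ltrBlDr ltrDl invr_gt0. Qed.

Lemma rseq_near dl : 0 < dl -> \forall n \near \oo, 1 - dl < rseq n.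
Proof.
move=> dl0; exists (Num.truncn dl^-1) => // n /= Hn.
rewrite /rseq ltrD2l ltrN2 invf_plt ?posrE//; apply: lt_le_trans (truncnS_gt _) _.
by rewrite ler_nat ltnS (leq_trans Hn).
Qed.

Lemma sqn_rseq_cvg f t : cvg (f (r%:C * cis t) @[r --> (1 : R)^'-]) ->
  sqn f (rseq n) t @[n --> \oo] --> rnorm (bdry f (cis t)) ^+ 2.
Proof.
move=> cf.
have H : rnorm (f ((rseq n)%:C * cis t)) @[n --> \oo] --> rnorm (bdry f (cis t)).
  apply/cvgrPdist_lt => e e0.
  have [dl dl0 Hd] := lim_radial_eps cf e0.
  near=> n; have nn : 1 - dl < rseq n by near: n; exact: rseq_near.
  have h := Hd (rseq n) nn (rseq_lt1 n).
  rewrite /=; apply: (le_lt_trans _ h); rewrite ler_distl.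
  set x := f _; set y := bdry f _.
  have h1 := rnormD y (x - y); rewrite addrC subrK in h1.
  have h2 := rnormD x (y - x); rewrite addrC subrK [rnorm (y - _)]rnormB in h2.
  by rewrite lerBlDr h2 h1.
have -> : sqn f (rseq n) t @[n --> \oo] =
    (rnorm (f ((rseq n)%:C * cis t)) * rnorm (f ((rseq n)%:C * cis t))) @[n --> \oo] by [].
by apply: cvgM; exact: H.
Unshelve. all: by end_near. Qed.

End radial_limits.

Section liminf.
Context {R : realType}.
Local Open Scope ereal_scope.

Lemma limn_einf_le (u : (\bar R)^nat) (k : \bar R) : (forall n, u n <= k) -> limn_einf u <= k.
Proof.
move=> H; rewrite limn_einf_lim; apply: lime_le; first exact: is_cvg_einfs.
apply: nearW => n; apply: le_trans (H n); apply: ereal_inf_lbound; exists n => //=.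
Qed.

Lemma limn_einf_ge (u : (\bar R)^nat) (k : \bar R) : (forall n, k <= u n) -> k <= limn_einf u.
Proof.
move=> H; rewrite limn_einf_lim; apply: lime_ge; first exact: is_cvg_einfs.
by apply: nearW => n; apply: le_ereal_inf_tmp => _ [m _ <-].
Qed.

Lemma measurable_fun_limn_einf d (T : measurableType d) (D : set T) (f : (T -> \bar R)^nat) :
  (forall n, measurable_fun D (f n)) -> measurable_fun D (fun x => limn_einf (f ^~ x)).
Proof.
move=> mf; apply: (emeasurable_fun_cvg (fun n x => einfs (f ^~ x) n)).
  by move=> n; exact: measurable_fun_einfs.
by move=> x _; rewrite limn_einf_lim; exact: is_cvg_einfs.
Qed.

End liminf.

Section almost_everywhere.
Context {R : realType}.
Notation mu := (@lebesgue_measure R).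

Lemma ae_imply (P Q : R -> Prop) : (forall t, P t -> Q t) ->
  {ae mu, forall t, P t} -> {ae mu, forall t, Q t}.
Proof. by move=> PQ; apply: negligibleS => t; apply: contra_not; exact: PQ. Qed.

Lemma ae_and (P Q : R -> Prop) : {ae mu, forall t, P t} -> {ae mu, forall t, Q t} ->
  {ae mu, forall t, P t /\ Q t}.
Proof.
move=> aP aQ; apply: negligibleS (negligibleU aP aQ) => t nPQ.
by apply: contrapT => /not_orP[/contrapT p /contrapT q]; apply: nPQ.
Qed.

End almost_everywhere.

(** * The mean square of the boundary values *)

Section isometry.
Context {R : realType} {E : hilbert R}.
Notation mu := (@lebesgue_measure R).
Notation I := (`[0%R, (2 * pi)%R]%classic : set R).
Implicit Types (f g : R[i] -> E) (r s t m rho : R).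

(* A measurable function that agrees almost everywhere with the squared norm of
   [bdry f], see [liminf_sqn_cvg]. *)
Definition liminf_sqn f (t : R) : \bar R := limn_einf (fun n => (sqn f (rseq n) t)%:E).

Lemma liminf_sqn_ge0 f t : (0 <= liminf_sqn f t)%E.
Proof. by apply: limn_einf_ge => n; rewrite lee_fin sqn_ge0. Qed.

Lemma sqn_measurable f r (D : set (measurableTypeR R)) : hol f 1 -> 0 <= r -> r < 1 -> measurable D ->
  measurable_fun D (fun t => (sqn f r t)%:E).
Proof.
move=> f1 r0 r1 mD; apply: continuous_EFin_measurable => //.
by apply: (sqn_cont f1); rewrite ger0_norm.
Qed.

Lemma liminf_sqn_measurable f : hol f 1 -> measurable_fun I (liminf_sqn f).
Proof.
move=> f1; apply: (measurable_fun_limn_einf (f := fun n t => (sqn f (rseq n) t)%:E)) => n.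
by apply: sqn_measurable => //; [exact: rseq_ge0|exact: rseq_lt1].
Qed.

Lemma integral_sqn f r : hol f 1 -> 0 <= r -> r < 1 ->
  (\int[mu]_(t in I) (sqn f r t)%:E = (mean2 f r)%:E)%E.
Proof.
by move=> f1 r0 r1; rewrite integral_segint// => t _; apply: (sqn_cont f1); rewrite ger0_norm.
Qed.

Lemma integral_phi_le f K : hol f 1 -> (forall r, 0 <= r -> r < 1 -> mean2 f r <= K) ->
  (\int[mu]_(t in I) liminf_sqn f t <= K%:E)%E.
Proof.
move=> f1 fK.
apply: (@le_trans _ _ (limn_einf (fun n => \int[mu]_(t in I) (sqn f (rseq n) t)%:E))%E).
  apply: fatou => //.
    by move=> n; apply: sqn_measurable => //; [exact: rseq_ge0|exact: rseq_lt1].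
  by move=> n x _; rewrite lee_fin sqn_ge0.
apply: limn_einf_le => n; rewrite integral_sqn ?rseq_ge0 ?rseq_lt1//.
by rewrite lee_fin fK ?rseq_ge0 ?rseq_lt1.
Qed.

Lemma liminf_sqn_cvg f t (l : E) : f (r%:C * cis t) @[r --> (1 : R)^'-] --> l ->
  liminf_sqn f t = (rnorm l ^+ 2)%:E.
Proof.
move=> fl; have lE : bdry f (cis t) = l by exact: cvg_lim.
have := @sqn_rseq_cvg R E f t; rewrite lE => H.
have {}H := H (cvgP _ fl).
have HE : (sqn f (rseq n) t)%:E @[n --> \oo] --> (rnorm l ^+ 2)%:E.
  by apply: cvg_EFin; [exact: nearW|exact: H].
rewrite /liminf_sqn is_cvg_limn_einfE; last exact: cvgP HE.
by apply/cvg_lim.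
Qed.

Lemma cvg_dilate f rho t : hol f 1 -> 0 < rho -> rho < 1 ->
  dilate f rho (r%:C * cis t) @[r --> (1 : R)^'-] --> f (rho%:C * cis t).
Proof.
move=> f1 rho0 rho1; apply/cvgrPdist_lt => -[e y].
rewrite ltcE/= => /andP[/eqP -> e0].
have [dl dl0 Hd] := hol_ccont f1 (ltac:(by rewrite cabs_polar gtr0_norm) : cabs (rho%:C * cis t) < 1) e0.
near=> r.
have r1 : r < 1 by near: r; exact: nbhs_left_lt.
have r2 : 1 - dl < r by near: r; apply: nbhs_left_gt; rewrite ltrBlDr ltrDl.
rewrite normVE ltcR rnormB /dilate mulrA -(rmorphM (real_complex R)); apply: Hd.
rewrite -mulrBl cabsM cabs_cis mulr1 -(rmorphB (real_complex R)) cabsR.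
rewrite -[X in _ - X]mulr1 -mulrBr normrM gtr0_norm//.
apply: (@le_lt_trans _ _ `|r - 1|); first by rewrite ler_piMl// ltW.
by rewrite distrC gtr0_norm ?subr_gt0// ltrBlDr addrC -ltrBlDr.
Unshelve. all: by end_near. Qed.

(** The triangle inequality squared, with the cross term weighted by [(eta a - b)^2 / eta >= 0]. The
    leading factor can be taken near 1, without which the exact norm would be lost. *)
Lemma rnorm_sqr_le_eta (x y : E) (eta : R) : 0 < eta ->
  rnorm x ^+ 2 <= (1 + eta) * rnorm y ^+ 2 + (1 + eta^-1) * rnorm (y - x) ^+ 2.
Proof.
move=> eta0.
have : rnorm x <= rnorm y + rnorm (y - x).
  by rewrite [rnorm (y - x)]rnormB -{1}(subrK y x) addrC rnormD.
have a0 := rnorm_ge0 y; have b0 := rnorm_ge0 (y - x); have c0 := rnorm_ge0 x.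
set a := rnorm y in a0 *; set b := rnorm (y - x) in b0 *; set c := rnorm x in c0 * => h.
have h2 : c ^+ 2 <= (a + b) ^+ 2 by rewrite ler_pXn2r ?nnegrE ?addr_ge0.
apply: le_trans h2 _.
have : 0 <= (eta * a - b) ^+ 2 / eta by rewrite divr_ge0 ?sqr_ge0 ?ltW.
have -> : (eta * a - b) ^+ 2 / eta = eta * a ^+ 2 - 2 * a * b + eta^-1 * b ^+ 2.
  by field; rewrite gt_eqF.
by clear; lra.
Qed.

(** The converse of Fatou's inequality, up to errors: [f(rho cis t)] is compared with [bdry f],
    their difference being the radial limit of [f - f(rho .)], to which Fatou's lemma applies with
    the bound [eps]. *)
Lemma mean2_le_liminf_sqn f rho eta eps : hol f 1 -> bounded_means f -> 0 < rho -> rho < 1 -> 0 < eta ->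
  (forall r, 0 <= r -> r < 1 -> mean2 (fun w => f w - dilate f rho w) r <= eps) ->
  ((mean2 f rho)%:E <= (1 + eta)%:E * \int[mu]_(t in I) liminf_sqn f t + ((1 + eta^-1) * eps)%:E)%E.
Proof.
move=> f1 fb rho0 rho1 eta0 small; pose g w := f w - dilate f rho w.
have g1 : hol g 1 by apply: holB => //; apply: hol_dilate => //; exact: ltW.
have e1 : 0 <= 1 + eta by rewrite addr_ge0// ltW.
have e2 : 0 <= 1 + eta^-1 by rewrite addr_ge0// invr_ge0 ltW.
have mp := liminf_sqn_measurable f1; have mg := liminf_sqn_measurable g1.
apply: (@le_trans _ _
    (\int[mu]_(t in I) ((1 + eta)%:E * liminf_sqn f t + (1 + eta^-1)%:E * liminf_sqn g t))%E).
  rewrite -integral_sqn//; last exact: ltW.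
  apply: ae_ge0_le_integral => //.
  - by move=> t _; rewrite lee_fin sqn_ge0.
  - by apply: sqn_measurable => //; exact: ltW.
  - by move=> t _; rewrite adde_ge0// mule_ge0 ?lee_fin// liminf_sqn_ge0.
  - by apply: emeasurable_funD; apply: measurable_funeM.
  apply: ae_imply (fatou_radial f1 fb) => t H tI.
  have cf := H tI.
  rewrite (liminf_sqn_cvg cf).
  have cg : g (r%:C * cis t) @[r --> (1 : R)^'-] --> bdry f (cis t) - f (rho%:C * cis t).
    by apply: cvgB; [exact: cf|exact: cvg_dilate].
  by rewrite (liminf_sqn_cvg cg) -!EFinM -EFinD lee_fin rnorm_sqr_le_eta.
rewrite ge0_integralD//.
- rewrite !ge0_integralZl//; last 2 first.
  + by move=> t _; exact: liminf_sqn_ge0.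
  + by move=> t _; exact: liminf_sqn_ge0.
  by rewrite leeD2l// EFinM lee_wpmul2l ?lee_fin//; exact: integral_phi_le.
- by move=> t _; rewrite mule_ge0 ?lee_fin// liminf_sqn_ge0.
- exact: measurable_funeM.
- by move=> t _; rewrite mule_ge0 ?lee_fin// liminf_sqn_ge0.
- exact: measurable_funeM.
Qed.

End isometry.

Section hardy_norm_formula.
Context {R : realType} {E : hilbert R}.
Notation mu := (@lebesgue_measure R).
Notation I := (`[0%R, (2 * pi)%R]%classic : set R).
Implicit Types (f g : R[i] -> E) (r s t m rho : R).

Lemma integral_liminf_sqn f L : hol f 1 -> (forall r, 0 <= r -> r < 1 -> mean2 f r <= L) ->
  (forall e, 0 < e -> exists r, [/\ 0 <= r, r < 1 & L - e < mean2 f r]) ->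
  (\int[mu]_(t in I) liminf_sqn f t = L%:E)%E.
Proof.
move=> f1 fL Lsup; have fb : bounded_means f by exists L.
have le := integral_phi_le f1 fL.
have ge0 : (0 <= \int[mu]_(t in I) liminf_sqn f t)%E by apply: integral_ge0 => t _; exact: liminf_sqn_ge0.
have fin : (\int[mu]_(t in I) liminf_sqn f t)%E \is a fin_num.
  by rewrite ge0_fin_numE// (le_lt_trans le) ?ltry.
move: le ge0; rewrite -(fineK fin); set J := fine _.
rewrite !lee_fin => JL J0; congr (_%:E); apply/eqP; rewrite eq_le JL/=.
(* Tail error [eta^2] is taken, so that [(1 + 1 / eta) eta^2 = eta^2 + eta <= 2 eta]. The third
   [eta] is the distance of the chosen mean from [L], and [eta J] comes from the factor
   [1 + eta]. *)
have key eta : 0 < eta -> eta <= 1 -> L <= J + eta * (3 + J).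
  move=> eta0 eta1; have [r0 [r00 r01 Hr0]] := Lsup _ eta0.
  have eta2 : 0 < eta ^+ 2 by rewrite exprn_gt0.
  have [rho0 [rho00 rho01 Hrho]] := mean2_tail f1 fL eta2.
  pose rho := Num.max rho0 r0.
  have rho1 : rho < 1 by rewrite /rho gt_max rho01.
  have rho_ge : rho0 <= rho by rewrite /rho le_max lexx.
  have rho_gt0 : 0 < rho := lt_le_trans rho00 rho_ge.
  have r0rho : r0 <= rho by rewrite /rho le_max lexx orbT.
  have h1 := mean2_mono f1 r00 r0rho rho1.
  have h2 := mean2_le_liminf_sqn f1 fb rho_gt0 rho1 eta0 (Hrho rho rho_ge rho1).
  rewrite -(fineK fin) -/J -EFinM -EFinD lee_fin in h2.
  have E1 : (1 + eta^-1) * eta ^+ 2 = eta ^+ 2 + eta by field; rewrite gt_eqF.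
  rewrite E1 in h2; have h3 : eta ^+ 2 <= eta by rewrite expr2 ler_piMl// ltW.
  by clear -Hr0 h1 h2 h3; lra.
apply/ler_addgt0Pr => e e0.
have J3 : 0 < 3 + J by rewrite ltr_pwDl.
pose eta := Num.min 1 (e / (3 + J)).
have eta0 : 0 < eta by rewrite /eta lt_min ltr01 divr_gt0.
have eta1 : eta <= 1 by rewrite /eta ge_min lexx.
apply: le_trans (key eta eta0 eta1) _; rewrite lerD2l -ler_pdivlMr//.
by rewrite /eta ge_min lexx orbT.
Qed.

Lemma circle_meanE f r : hol f 1 -> 0 <= r -> r < 1 ->
  circle_mean f r = (Num.sqrt (mean2 f r / (2 * pi)))%:E.
Proof.
move=> f1 r0 r1; rewrite /circle_mean.
have -> : (\int[mu]_(t in I) (rnorm (f (r%:C * cis t)) ^+ 2)%:E = (mean2 f r)%:E)%E.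
  exact: integral_sqn.
rewrite -EFinM poweR_EFin powR12_sqrt; last first.
  by rewrite mulr_ge0 ?mean2_ge0// invr_ge0 mulr_ge0// pi_ge0.
by rewrite mulrC.
Qed.

(** The isometry of H^2 into L^2 of the circle: the supremum of the means is both the integral of
    the boundary values and, after normalization by [2 pi] and a square root, the Hardy norm. *)
Lemma hardy_norm_liminf_sqn f : hol f 1 -> bounded_means f -> exists L : R,
  [/\ 0 <= L, (\int[mu]_(t in I) liminf_sqn f t = L%:E)%E &
      hardy_norm f = (Num.sqrt (L / (2 * pi)))%:E].
Proof.
move=> f1 [K fK].
pose A := [set mean2 f r | r in [set r | 0 <= r < 1]].
have As : has_sup A.
  split; first by exists (mean2 f 0), 0; rewrite //= lexx ltr01.
  by exists K => _ [r /= /andP[r0 r1] <-]; exact: fK.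
have Ab r : 0 <= r -> r < 1 -> mean2 f r <= sup A.
  by move=> r0 r1; apply: sup_upper_bound => //; exists r; rewrite //= r0.
have Aa e : 0 < e -> exists r, [/\ 0 <= r, r < 1 & sup A - e < mean2 f r].
  move=> e0; have [_ [r /= /andP[r0 r1] <-] h] := sup_adherent e0 As.
  by exists r.
have pi2 : 0 < 2 * pi :> R by rewrite mulr_gt0// pi_gt0.
exists (sup A); split.
- by apply: le_trans (Ab 0 (lexx _) ltr01); exact: mean2_ge0.
- exact: integral_liminf_sqn.
apply/eqP; rewrite eq_le; apply/andP; split.
  apply: ge_ereal_sup => _ [r /= + <-]; rewrite in_itv/= => /andP[r0 r1].
  rewrite circle_meanE ?(ltW r0)// lee_fin ler_wsqrtr// ler_pM2r ?invr_gt0//.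
  exact: Ab (ltW r0) r1.
have ub r : 0 < r -> r < 1 -> ((Num.sqrt (mean2 f r / (2 * pi)))%:E <= hardy_norm f)%E.
  move=> r0 r1; rewrite -circle_meanE ?(ltW r0)//.
  by apply: ereal_sup_ubound; exists r; rewrite //= in_itv/= r0.
rewrite leNgt; apply/negP => lt.
have half : 0 < 1 / 2 :> R by [].
have half1 : 1 / 2 < 1 :> R by lra.
have h0 : (0 <= hardy_norm f)%E.
  by apply: le_trans (ub _ half half1); rewrite lee_fin sqrtr_ge0.
have fin : hardy_norm f \is a fin_num by rewrite ge0_fin_numE// (lt_trans lt) ?ltry.
move: lt h0 ub; rewrite -(fineK fin); set s := fine _.
rewrite lte_fin lee_fin => lt s0 ub.
have lt2 : s ^+ 2 * (2 * pi) < sup A.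
  rewrite -ltr_pdivlMr// -(@sqr_sqrtr _ (sup A / (2 * pi))).
    by rewrite ltr_pXn2r ?nnegrE ?sqrtr_ge0.
  by rewrite divr_ge0 ?(ltW pi2)// (le_trans (mean2_ge0 f 0))// Ab.
have [r [r0 r1 Hr]] := Aa (sup A - s ^+ 2 * (2 * pi)) ltac:(by rewrite subr_gt0).
(* The supremum [A] admits radius 0 but [hardy_norm] does not; monotonicity lets a positive radius
   replace [r]. *)
pose q := Num.max r (1 / 2).
have q1 : q < 1 by rewrite /q gt_max r1.
have q0 : 0 < q by rewrite /q lt_max half orbT.
have rq : r <= q by rewrite /q le_max lexx.
have := ub q q0 q1; rewrite lee_fin leNgt => /negP; apply.
rewrite -(@ltr_pXn2r _ 2) ?nnegrE ?sqrtr_ge0// sqr_sqrtr; last first.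
  by rewrite divr_ge0 ?mean2_ge0// ltW.
rewrite ltr_pdivlMr//; apply: lt_le_trans (mean2_mono f1 r0 rq q1).
by clear -Hr; lra.
Qed.

Lemma disc_cabs (z : R[i]) : disc R z <-> cabs z < 1.
Proof. by rewrite /disc /= normCE -(ltcR (cabs z) 1). Qed.

Lemma analytic_hol f : analytic f <-> hol f 1.
Proof.
split=> [fa|/holP f1 z /disc_cabs]; last exact: f1.
by apply/holP => w /disc_cabs; exact: fa.
Qed.

Lemma H2_hol (F : set E) f : H2 F f -> hol f 1 /\ bounded_means f.
Proof.
move=> [/analytic_hol f1 _ hf]; split=> //.
have pi2 : 0 < 2 * pi :> R by rewrite mulr_gt0// pi_gt0.
have ub r : 0 < r -> r < 1 -> ((Num.sqrt (mean2 f r / (2 * pi)))%:E <= hardy_norm f)%E.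
  move=> r0 r1; rewrite -circle_meanE ?(ltW r0)//.
  by apply: ereal_sup_ubound; exists r; rewrite //= in_itv/= r0.
have half : 0 < 1 / 2 :> R by [].
have half1 : 1 / 2 < 1 :> R by lra.
have h0 : (0 <= hardy_norm f)%E.
  by apply: le_trans (ub _ half half1); rewrite lee_fin sqrtr_ge0.
have fin : hardy_norm f \is a fin_num by rewrite ge0_fin_numE.
move: h0 ub; rewrite -(fineK fin); set s := fine _; rewrite lee_fin => s0 ub.
exists (s ^+ 2 * (2 * pi)) => r r0 r1; pose q := Num.max r (1 / 2).
have q1 : q < 1 by rewrite /q gt_max r1.
have q0 : 0 < q by rewrite /q lt_max half orbT.
have rq : r <= q by rewrite /q le_max lexx.
apply: le_trans (mean2_mono f1 r0 rq q1) _.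
have := ub q q0 q1; rewrite lee_fin -ler_pdivrMr//.
rewrite -(@ler_pXn2r _ 2) ?nnegrE ?sqrtr_ge0// sqr_sqrtr//.
by rewrite divr_ge0 ?mean2_ge0// ltW.
Qed.

End hardy_norm_formula.

(** * The wedge product as antisymmetrization *)

Section wedge_theory.
Context {R : realType} {E : hilbert R} (W : tensor_square E).
Implicit Types (x y : E).

(** The difference of two candidates lies in [F] and is orthogonal to [F], hence to itself. *)
Lemma orth_proj_unique (V : hilbert R) (F : set V) (x p : V) :
  (forall u v, F u -> F v -> F (u - v)) -> F p -> (forall u, F u -> orth (x - p) u) ->
  orth_proj F x = p.
Proof.
move=> FB Fp Hp; apply: xget_unique; first by split.
move=> q [Fq Hq]; have Fpq := FB _ _ Fq Fp.
apply/eqP; rewrite -subr_eq0 -rnorm_eq0 -sqrf_eq0.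
have : dotp V (q - p) (q - p) = 0.
  have -> : dotp V (q - p) (q - p) = dotp V (x - p) (q - p) - dotp V (x - q) (q - p).
    by rewrite -linearBl; congr (dotp V _ _); rewrite opprB [RHS]addrC addrA subrK.
  by rewrite (Hp _ Fpq) (Hq _ Fpq) subrr.
by rewrite dotp_rnorm => /(congr1 (@complex.Re R)) /= ->.
Qed.

Lemma wedge2B (u v : W) : wedge2 W u -> wedge2 W v -> wedge2 W (u - v).
Proof. by rewrite /wedge2 /= linearB => -> ->; rewrite opprB opprK addrC. Qed.

Lemma half_wedge2 x y : wedge2 W (2^-1 *: (tensor W x y - tensor W y x)).
Proof. by rewrite /wedge2 /= linearZ linearB /= !flip_tensor -scalerN opprB. Qed.

(** The remainder is half the symmetric sum, fixed by the flip. As the flip is unitary and negates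
    antisymmetric tensors, the inner product of the two kinds equals its own opposite. *)
Lemma wedgeE x y : wedge W x y = 2^-1 *: (tensor W x y - tensor W y x).
Proof.
apply: orth_proj_unique; [exact: wedge2B|exact: half_wedge2|] => a Fa.
have -> : tensor W x y - 2^-1 *: (tensor W x y - tensor W y x) =
    2^-1 *: (tensor W x y + tensor W y x).
  rewrite -{1}[tensor W x y]scale1r scalerBr scalerDr opprB addrCA addrC -scalerBl.
  by congr (_ *: _ + _); rewrite {1}[1]splitr div1r addrK.
set s := 2^-1 *: _.
have fs : flip W s = s by rewrite /s linearZ linearD /= !flip_tensor addrC.
have := @flip_unitary _ _ W s a; rewrite fs Fa linearNr => h.
have : dotp W s a *+ 2 = 0 by rewrite mulr2n -{1}h addNr.
by move/eqP; rewrite mulrn_eq0 /= => /eqP.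
Qed.

Lemma wedge_in x y : wedge2 W (wedge W x y).
Proof. by rewrite wedgeE; exact: half_wedge2. Qed.

Lemma wedgeBl y : {morph (fun x => wedge W x y) : x x' / x - x'}.
Proof.
move=> x x'; rewrite !wedgeE linearBl linearBr -scalerBr; congr (_ *: _).
by rewrite !opprB addrACA [RHS]addrACA; congr (_ + _); rewrite addrC.
Qed.

Lemma wedgeC x y : wedge W x y = - wedge W y x.
Proof. by rewrite !wedgeE -scalerN opprB. Qed.

Lemma wedgeBr x : {morph wedge W x : y y' / y - y'}.
Proof. by move=> y y'; rewrite wedgeC wedgeBl (wedgeC x y) (wedgeC x y') opprB opprK addrC. Qed.

Lemma wedgeZl a y : {morph (fun x => wedge W x y) : x / a *: x}.
Proof.
by move=> x; rewrite !wedgeE linearZl_LR linearZr_LR -scalerBr !scalerA mulrC.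
Qed.

Lemma wedgeZr a x : {morph wedge W x : y / a *: y}.
Proof. by move=> y; rewrite wedgeC wedgeZl -scalerN -wedgeC. Qed.

Lemma dotp_subsub (V : hilbert R) (u v : V) :
  dotp V (u - v) (u - v) = dotp V u u - dotp V u v - (dotp V v u - dotp V v v).
Proof. by rewrite linearBl !linearBr. Qed.

(** The Gram determinant of [x] and [y]: the two halves give [1 / 4], which cancels against the
    factor 2 of [dotp_tensor] and the pairing of equal terms among the four products. *)
Lemma rnorm_wedge x y : rnorm (wedge W x y) ^+ 2 =
  rnorm x ^+ 2 * rnorm y ^+ 2 - cabs (dotp E x y) ^+ 2.
Proof.
have c2 : (2^-1 : R[i])^*%C = 2^-1 by rewrite conjc_inv conjc_nat.
apply: (@complexI R); rewrite -dotp_rnorm wedgeE dotpZl dotpZr c2.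
rewrite dotp_subsub !dotp_tensor !dotp_rnorm (dotp_conj y x).
have dd : dotp E x y * (dotp E x y)^*%C = (cabs (dotp E x y) ^+ 2)%:C.
  by rewrite -sqr_normc normCE rmorphXn.
have CE (a b c : R) : (a * b - c)%:C = a%:C * b%:C - c%:C by rewrite rmorphB rmorphM.
rewrite CE -dd.
set d := dotp E x y; set a := (rnorm x ^+ 2)%:C; set b := (rnorm y ^+ 2)%:C.
by field.
Qed.

Lemma rnorm_wedge_le x y : rnorm (wedge W x y) <= 1 * (rnorm x * rnorm y).
Proof.
rewrite mul1r -(@ler_pXn2r _ 2) ?nnegrE ?mulr_ge0 ?rnorm_ge0//.
by rewrite rnorm_wedge exprMn lerBlDr lerDl sqr_ge0.
Qed.

End wedge_theory.

(** * The creation operator and the equality of norms *)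

Section creation_operator.
Context {R : realType} {E : hilbert R} (W : tensor_square E).
Notation mu := (@lebesgue_measure R).
Notation I := (`[0%R, (2 * pi)%R]%classic : set R).
Implicit Types (f x xi : R[i] -> E).

Lemma creation_hol xi x S : hol xi S -> hol x S -> hol (creation W xi x) S.
Proof.
move=> xiS xS w wS; have [d Hd] := xiS w wS; have [d' Hd'] := xS w wS.
exists (wedge W d (x w) + wedge W (xi w) d').
apply: (cdiff_bilinear (B := wedge W) _ _ _ _ _ Hd Hd').
- exact: wedgeBl.
- exact: wedgeBr.
- by move=> a y; exact: wedgeZl.
- by move=> a y; exact: wedgeZr.
- exact: rnorm_wedge_le.
Qed.

Lemma Hoo_bounded (F : set E) f : Hoo F f -> exists2 M : R, 0 <= M &
  forall w, cabs w < 1 -> rnorm (f w) <= M.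
Proof.
move=> [_ _ [M HM]]; exists `|M| => // w /disc_cabs/HM h.
exact: le_trans h (ler_norm _).
Qed.

Lemma Hoo_hol (F : set E) f : Hoo F f -> hol f 1 /\ bounded_means f.
Proof.
move=> Hf; have [M M0 HM] := Hoo_bounded Hf; have [/analytic_hol f1 _ _] := Hf.
split=> //; exists (2 * pi * M ^+ 2) => r r0 r1.
apply: (mean2_le_sup f1); rewrite ?ger0_norm ?sqr_ge0// => t _ _.
by rewrite /sqn ler_pXn2r ?nnegrE ?rnorm_ge0// HM// cabs_polar ger0_norm.
Qed.

Lemma creation_bounded xi x : hol xi 1 -> hol x 1 ->
  (exists2 M : R, 0 <= M & forall w, cabs w < 1 -> rnorm (xi w) <= M) ->
  bounded_means x -> bounded_means (creation W xi x).
Proof.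
move=> xi1 x1 [M M0 HM] [K HK]; exists (M ^+ 2 * K) => r r0 r1.
have rr : `|r| < 1 by rewrite ger0_norm.
have cx : cont_on (sqn x r) 0 (2 * pi) by move=> t _; exact: (sqn_cont x1).
apply: (@le_trans _ _ (M ^+ 2 * mean2 x r)); last by rewrite ler_wpM2l ?sqr_ge0// HK.
rewrite /mean2 -segintZ//; apply: segint_le.
- by move=> t _; apply: (sqn_cont (creation_hol xi1 x1)).
- by apply: cont_onM => //; exact: cont_on_cst.
- move=> t _ _; rewrite /sqn /creation rnorm_wedge.
  set w := r%:C * cis t.
  have h : rnorm (xi w) ^+ 2 <= M ^+ 2.
    by rewrite ler_pXn2r ?nnegrE ?rnorm_ge0// HM// cabs_polar.
  have h2 : rnorm (xi w) ^+ 2 * rnorm (x w) ^+ 2 <= M ^+ 2 * rnorm (x w) ^+ 2.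
    by rewrite ler_wpM2r// sqr_ge0.
  have := sqr_ge0 (cabs (dotp E (xi w) (x w))).
  by clear -h2; lra.
Qed.

Lemma hol_H2 (F : set W) (f : R[i] -> W) : hol f 1 -> bounded_means f -> (forall z, F (f z)) -> H2 F f.
Proof.
move=> f1 fb fF; split=> //; first by apply/analytic_hol.
by have [L [_ _ ->]] := hardy_norm_liminf_sqn f1 fb; exact: ltry.
Qed.

Lemma wedge_cvg (u v : R -> E) (a b : E) : u r @[r --> (1 : R)^'-] --> a ->
  v r @[r --> (1 : R)^'-] --> b -> wedge W (u r) (v r) @[r --> (1 : R)^'-] --> wedge W a b.
Proof.
move=> ua vb; apply/cvgrPdist_lt => -[e y].
rewrite ltcE/= => /andP[/eqP -> e0].
have a0 := rnorm_ge0 a; have b0 := rnorm_ge0 b.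
pose K := rnorm a + rnorm b + 1; have K0 : 0 < K by rewrite ltr_wpDl// addr_ge0.
(* The bound 1 keeps [rnorm (v r)] below [rnorm b + 1]; then [q K <= e] covers both error terms. *)
pose q := Num.min 1 (e / K).
have q0 : 0 < q by rewrite /q lt_min ltr01 divr_gt0.
have q1 : q <= 1 by rewrite /q ge_min lexx.
have qe : q <= e / K by rewrite /q ge_min lexx orbT.
have [d1 d10 H1] := cvg_radial_eps ua q0.
have [d2 d20 H2] := cvg_radial_eps vb q0.
near=> r.
have r1 : r < 1 by near: r; exact: nbhs_left_lt.
have r2 : 1 - d1 < r by near: r; apply: nbhs_left_gt; rewrite ltrBlDr ltrDl.
have r3 : 1 - d2 < r by near: r; apply: nbhs_left_gt; rewrite ltrBlDr ltrDl.
have {}H1 := H1 r r2 r1; have {}H2 := H2 r r3 r1.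
rewrite normVE ltcR rnormB.
have -> : wedge W (u r) (v r) - wedge W a b = wedge W (u r - a) (v r) + wedge W a (v r - b).
  by rewrite wedgeBl wedgeBr addrA subrK.
have vr : rnorm (v r) <= rnorm b + 1.
  rewrite -(subrK b (v r)) addrC; apply: le_trans (rnormD _ _) _.
  by rewrite lerD2l (le_trans (ltW H2)).
apply: le_lt_trans (rnormD _ _) _.
have E1 : rnorm (wedge W (u r - a) (v r)) <= rnorm (u r - a) * (rnorm b + 1).
  apply: le_trans (rnorm_wedge_le _ _ _) _; rewrite mul1r.
  by rewrite ler_wpM2l ?rnorm_ge0.
have E2 : rnorm (wedge W a (v r - b)) <= rnorm a * q.
  apply: le_trans (rnorm_wedge_le _ _ _) _; rewrite mul1r.
  by rewrite ler_wpM2l ?rnorm_ge0// ltW.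
have E3 : rnorm (u r - a) * (rnorm b + 1) < q * (rnorm b + 1) by rewrite ltr_pM2r// ltr_wpDl.
have E4 : q * K <= e by rewrite -ler_pdivlMr.
have E5 : q * K = rnorm a * q + q * (rnorm b + 1) by rewrite /K; ring.
by clear -E1 E2 E3 E4 E5; lra.
Unshelve. all: by end_near. Qed.

Lemma liminf_sqn_creation xi x : inner xi -> H2 [set: E] x ->
  {ae mu, forall t, t \in `[0, 2 * pi] ->
    liminf_sqn x t = (rnorm (bdry x (cis t)) ^+ 2)%:E /\
    liminf_sqn (creation W xi x) t =
      (rnorm (bdry x (cis t)) ^+ 2 - cabs (dotp E (bdry x (cis t)) (bdry xi (cis t))) ^+ 2)%:E}.
Proof.
move=> [Hxi xi_in] Hx; have [x1 xb] := H2_hol Hx; have [xi1 xib] := Hoo_hol Hxi.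
apply: ae_imply (ae_and xi_in (ae_and (fatou_radial xi1 xib) (fatou_radial x1 xb))).
move=> t [H1 [H2 H3]] tI; have c1 := H2 tI; have c2 := H3 tI.
split; first exact: liminf_sqn_cvg c2.
have cy : creation W xi x (r%:C * cis t) @[r --> (1 : R)^'-] --> wedge W (bdry xi (cis t)) (bdry x (cis t)).
  exact: wedge_cvg c1 c2.
rewrite (liminf_sqn_cvg cy) rnorm_wedge.
rewrite (H1 tI).
by rewrite expr1n mul1r dotp_conj cabs_conj.
Qed.

(** Both squared norms are finite integrals of the functions [liminf_sqn], whose difference is
    almost everywhere [|<x, xi>|^2 >= 0]; it integrates to zero exactly when it vanishes almost
    everywhere. *)
Lemma hardy_norm_creation_eq xi x : inner xi -> H2 [set: E] x ->
  hardy_norm (creation W xi x) = hardy_norm x <->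
  {ae mu, forall t, t \in `[0, 2 * pi] -> orth (bdry x (cis t)) (bdry xi (cis t))}.
Proof.
move=> xi_in Hx; have [x1 xb] := H2_hol Hx; have [xi1 xib] := Hoo_hol xi_in.1.
have y1 := creation_hol xi1 x1.
have yb := creation_bounded xi1 x1 (Hoo_bounded xi_in.1) xb.
have [Lx [Lx0 ix ->]] := hardy_norm_liminf_sqn x1 xb.
have [Ly [Ly0 iy ->]] := hardy_norm_liminf_sqn y1 yb.
have aphi := liminf_sqn_creation xi_in Hx.
have pi2 : 0 < 2 * pi :> R by rewrite mulr_gt0// pi_gt0.
have mx := liminf_sqn_measurable x1; have my := liminf_sqn_measurable y1.
have -> : (Num.sqrt (Ly / (2 * pi)))%:E = (Num.sqrt (Lx / (2 * pi)))%:E <-> Ly = Lx.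
  split=> [[]|->//] /eqP; rewrite eqr_sqrt ?divr_ge0 ?(ltW pi2)//.
  by move=> /eqP/(mulIf _)-> //; rewrite invr_neq0// gt_eqF.
split=> [LE|orth].
(* Formed from the lower limits, which are measurable, rather than from the boundary values
   themselves. *)
- pose d t := (liminf_sqn x t - liminf_sqn (creation W xi x) t)%E.
  have md : measurable_fun I d by exact: emeasurable_funB.
  have mad : measurable_fun I (fun t => `|d t|%E) by exact: measurableT_comp.
  have : (\int[mu]_(t in I) `|d t| = 0)%E.
    (* Additivity is used for nonnegative functions; the finite integral common to both sides is
       cancelled afterwards. *)
    have h : (\int[mu]_(t in I) liminf_sqn x t =
        \int[mu]_(t in I) (liminf_sqn (creation W xi x) t + `|d t|))%E.
      apply: ge0_ae_eq_integral => //.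
      + exact: emeasurable_funD.
      + by move=> t _; exact: liminf_sqn_ge0.
      + by move=> t _; rewrite adde_ge0// liminf_sqn_ge0.
      apply: ae_imply aphi => t H tI; have [e1 e2] := H tI.
      rewrite /d e1 e2 -EFinB /= -EFinD; congr (_%:E).
      set a := _ ^+ 2; set c := cabs _ ^+ 2; have -> : a - (a - c) = c by ring.
      by rewrite ger0_norm ?sqr_ge0// subrK.
    have e : (\int[mu]_(t in I) (liminf_sqn (creation W xi x) t + `|d t|) =
        \int[mu]_(t in I) liminf_sqn (creation W xi x) t + \int[mu]_(t in I) `|d t|)%E.
      by rewrite ge0_integralD// => t _; exact: liminf_sqn_ge0.
    rewrite e in h.
    rewrite ix iy LE in h.
    by move: h; case: (\int[mu]_(t in I) _)%E => [r| |]// [] /eqP;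
      rewrite -subr_eq0 opprD addrA subrr sub0r oppr_eq0 => /eqP ->.
  move=> /(ae_eq_integral_abs mu _ md).1 H.
  apply: ae_imply (ae_and (H _) aphi) => // t [H1 H2] tI.
  have [e1 e2] := H2 tI; have := H1 tI; rewrite /d e1 e2 /cst -EFinB => -[].
  set a := _ ^+ 2; set c := cabs _ ^+ 2; have -> : a - (a - c) = c by ring.
  move=> /eqP; rewrite sqrf_eq0 cabs_eq0 => /eqP h.
  exact: h.
- have h : (\int[mu]_(t in I) liminf_sqn x t = \int[mu]_(t in I) (liminf_sqn (creation W xi x) t))%E.
    apply: ge0_ae_eq_integral => //.
    + by move=> t _; exact: liminf_sqn_ge0.
    + by move=> t _; exact: liminf_sqn_ge0.
    apply: ae_imply (ae_and orth aphi) => t [H1 H2] tI.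
    have [-> ->] := H2 tI; rewrite (H1 tI : dotp E _ _ = 0) cabs0 expr0n subr0//.
  by move: h; rewrite ix iy => -[].
Qed.

End creation_operator.

Unset Implicit Arguments.
Set Strict Implicit.

Theorem lemma4p20 (R : realType) (E : hilbert R) (W : tensor_square E)
    (sepE : separable E) (xi : R[i] -> E) (inner_xi : inner xi) :
  (forall x, H2 [set: E] x -> H2 (wedge2 W) (creation W xi x)) /\
  [set x | H2 [set: E] x /\ hardy_norm (creation W xi x) = hardy_norm x] =
  H2 [set: E] `&` @bdry R E @^-1` POC [set bdry xi] (@bdry R E @` H2 [set: E]).
Proof.
have [xi1 xib] := Hoo_hol inner_xi.1; split.
  move=> x Hx; have [x1 xb] := H2_hol Hx; apply: hol_H2.
  - exact: creation_hol.
  - exact: creation_bounded (Hoo_bounded inner_xi.1) xb.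
  - by move=> z; exact: wedge_in.
(* [POC] is a set of functions on the circle, so membership is tested on [bdry x]; [x] itself
   witnesses that [bdry x] is a boundary function of H^2. *)
apply/seteqP; split=> x /=.
  move=> [Hx /(hardy_norm_creation_eq W inner_xi Hx) H]; split=> //; split; first by exists x.
  by apply: ae_imply H => t H tI _ ->; exact: H.
move=> [Hx [_ H]]; split=> //; apply/(hardy_norm_creation_eq W inner_xi Hx).
by apply: ae_imply H => t H tI; exact: (H tI (bdry xi) erefl).
Qed.
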